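(* Let $k$ be a field, $n$ a positive integer, $a_1,\dots,a_n$ integers with $a_u \ge 2$ for all $u$, and for each pair $1\le i<j\le n$ let $q_{ij}$ be a nonzero element of $k$. Let $$\Lambda = k\langle X_1,\dots,X_n\rangle / (X_u^{a_u} \text{ for } 1\le u\le n,\; X_iX_j - q_{ij}X_jX_i \text{ for } 1\le i<j\le n).$$ Then the representation dimension of $\Lambda$ is at most $2n$, i.e. $\operatorname{repdim}\Lambda \le 2n$.
   Context: For an Artin algebra $\Lambda$, $\operatorname{mod}\Lambda$ is the category of finitely generated (left) $\Lambda$-modules. The representation dimension of $\Lambda$ is $$\operatorname{repdim}\Lambda = \inf\{\operatorname{gldim}\operatorname{End}_\Lambda(M) \mid M \in \operatorname{mod}\Lambda \text{ generates and cogenerates } \operatorname{mod}\Lambda\},$$ where $\operatorname{gldim}$ denotes global dimension. $M$ generates and cogenerates $\operatorname{mod}\Lambda$ if every indecomposable projective and every indecomposable injective finitely generated $\Lambda$-module is a direct summand of $M$. The algebra $\Lambda$ in the claim is called a quantum complete intersection of codimension $n$; it is finite dimensional over $k$ of dimension $\prod_u a_u$. *)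

(* Defs.v *)
From HB Require Import structures.
From mathcomp Require Import all_boot all_order all_algebra.
From mathcomp Require Import boolp classical_sets.
From mathcomp Require Import monalg.

Set Implicit Arguments.
Unset Strict Implicit.
Unset Printing Implicit Defensive.

Import GRing.Theory.

Local Open Scope ring_scope.
Local Open Scope classical_set_scope.
Local Open Scope quotient_scope.

(* Extended natural numbers, [None] standing for infinity. *)
Definition enat := option nat.

Definition leqe (x y : enat) : bool :=
  match x, y with
  | _, None => true
  | Some m, Some n => (m <= n)%N
  | None, Some _ => false
  end.

Lemma asboolW_ex (P : nat -> Prop) : (exists n, P n) -> exists n, `[< P n >].
Proof. by case=> n Pn; exists n; apply/asboolP. Qed.

Definition enat_inf (A : set enat) : enat :=
  if pselect (exists n, A (Some n)) is left h
  then Some (ex_minn (asboolW_ex h)) else None.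

Definition enat_sup (A : set enat) : enat :=
  enat_inf [set y | forall x, A x -> leqe x y].

Lemma enat_inf_glb (A : set enat) (y : enat) :
  leqe y (enat_inf A) <-> (forall x, A x -> leqe y x).
Proof.
rewrite /enat_inf; case: pselect => [h|nh]; last first.
  split=> [_ [m Am|_]|_]; [by case: nh; exists m | by case: y | by case: y].
case: ex_minnP => m /asboolP Am min_m; split=> [|lb]; last exact: lb.
case: y => [y|] //= le_ym [x|] // Ax.
by apply: leq_trans le_ym (min_m _ _); apply/asboolP.
Qed.

Lemma enat_sup_lub (A : set enat) (y : enat) :
  leqe (enat_sup A) y <-> (forall x, A x -> leqe x y).
Proof.
rewrite /enat_sup /enat_inf; case: pselect => [h|nh].
  case: ex_minnP => m /asboolP Am min_m; split=> [|ub].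
    case: y => [y|] /= le_my x Ax; last by case: x Ax.
    by case: x Ax => [x|] /Am //= le_xm; apply: leq_trans le_my.
  by case: y ub => [y|] // ub; apply: min_m; apply/asboolP.
case: y => [y|]; split=> //; first by move=> ub; case: nh; exists y.
by move=> _ [].
Qed.

Section TwoSidedQuotient.
Variables (R : pzRingType) (S : set R).

Definition two_sided_ideal (I : set R) : Prop :=
  [/\ I 0, forall x y, I x -> I y -> I (x - y),
      forall a x, I x -> I (a * x) & forall a x, I x -> I (x * a)].

Definition ideal_gen : set R :=
  [set x | forall I : set R, two_sided_ideal I -> S `<=` I -> I x].

Lemma ideal_gen_two_sided : two_sided_ideal ideal_gen.
Proof.
split=> [I [] //|x y Ix Iy I idI SI|a x Ix I idI SI|a x Ix I idI SI].
- by have [_ IB _ _] := idI; apply: IB; [apply: Ix | apply: Iy].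
- by have [_ _ IMl _] := idI; apply: IMl; apply: Ix.
- by have [_ _ _ IMr] := idI; apply: IMr; apply: Ix.
Qed.

Definition ideal_gen_pred : {pred R} := fun x => `[< ideal_gen x >].

Lemma ideal_gen_predP x : reflect (ideal_gen x) (x \in ideal_gen_pred).
Proof. exact: asboolP. Qed.

Lemma ideal_gen_zmod_closed : zmod_closed ideal_gen_pred.
Proof.
case: ideal_gen_two_sided => I0 IB _ _; split; first exact/ideal_gen_predP.
by move=> x y /ideal_gen_predP Ix /ideal_gen_predP Iy;
  apply/ideal_gen_predP; apply: IB.
Qed.

HB.instance Definition _ :=
  GRing.isZmodClosed.Build R ideal_gen_pred ideal_gen_zmod_closed.

(* The ring R / (S), built on the library's quotient of additive groups since
   the library has quotient rings of commutative rings only. *)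
Definition quot_ring := {ideal_quot ideal_gen_pred}.

HB.instance Definition _ := GRing.Zmodule.on quot_ring.
HB.instance Definition _ := EqQuotient.on quot_ring.

Definition quot_proj (x : R) : quot_ring := \pi_quot_ring x.
Definition quot_one : quot_ring := quot_proj 1.
Definition quot_mul (x y : quot_ring) : quot_ring :=
  quot_proj (repr x * repr y).

Lemma quot_proj_eq x y : quot_proj x = quot_proj y <-> ideal_gen (x - y).
Proof.
split=> [/eqP|Ixy].
  by rewrite -Quotient.idealrBE => /ideal_gen_predP.
by apply/eqP; rewrite -Quotient.idealrBE; apply/ideal_gen_predP.
Qed.

Lemma quot_projK x : quot_proj (repr x) = x.
Proof. exact: reprK. Qed.

Lemma quot_projD : {morph quot_proj : x y / x + y}.
Proof. by move=> x y; rewrite /quot_proj !piE. Qed.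

Lemma quot_projM : {morph quot_proj : x y / x * y >-> quot_mul x y}.
Proof.
move=> x y; apply/quot_proj_eq.
set x' := repr _; set y' := repr _.
have [_ IB IMl IMr] := ideal_gen_two_sided.
have Ix : ideal_gen (x - x') by apply/quot_proj_eq; rewrite quot_projK.
have Iy : ideal_gen (y' - y) by apply/quot_proj_eq; rewrite quot_projK.
have -> : x * y - x' * y' = (x - x') * y - x' * (y' - y).
  by rewrite mulrBl mulrBr opprB addrA addrNK.
by apply: IB; [apply: IMr | apply: IMl].
Qed.

Lemma quot_mulA : associative quot_mul.
Proof.
move=> x y z; rewrite -[x]quot_projK -[y]quot_projK -[z]quot_projK.
by rewrite -!quot_projM mulrA.
Qed.

Lemma quot_mul1x : left_id quot_one quot_mul.
Proof. by move=> x; rewrite -[x]quot_projK -quot_projM mul1r. Qed.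

Lemma quot_mulx1 : right_id quot_one quot_mul.
Proof. by move=> x; rewrite -[x]quot_projK -quot_projM mulr1. Qed.

Lemma quot_mulDl : left_distributive quot_mul +%R.
Proof.
move=> x y z; rewrite -[x]quot_projK -[y]quot_projK -[z]quot_projK.
by rewrite -quot_projD -!quot_projM mulrDl quot_projD.
Qed.

Lemma quot_mulDr : right_distributive quot_mul +%R.
Proof.
move=> x y z; rewrite -[x]quot_projK -[y]quot_projK -[z]quot_projK.
by rewrite -quot_projD -!quot_projM mulrDr quot_projD.
Qed.

HB.instance Definition _ := GRing.Zmodule_isPzRing.Build quot_ring
  quot_mulA quot_mul1x quot_mulx1 quot_mulDl quot_mulDr.

End TwoSidedQuotient.

(* Modules are left modules, [lmodType R]. *)
Section Modules.
Variable R : pzRingType.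
Implicit Types M N P E X : lmodType R.

Definition surjective (A B : Type) (f : A -> B) : Prop :=
  forall y, exists x, f x = y.

Definition zero_module M : Prop := forall x : M, x = 0.

Definition fin_gen M : Prop :=
  exists s : seq M, forall x : M,
    exists c : 'I_(size s) -> R, x = \sum_i c i *: s`_i.

Definition direct_summand N M : Prop :=
  exists (N' : lmodType R) (f : {linear (N * N')%type -> M}), bijective f.

Definition indecomposable M : Prop :=
  ~ zero_module M /\
  forall (A B : lmodType R) (f : {linear (A * B)%type -> M}),
    bijective f -> zero_module A \/ zero_module B.

Definition projective P : Prop :=
  forall (A B : lmodType R) (g : {linear A -> B}) (f : {linear P -> B}),
    surjective g -> exists h : {linear P -> A}, forall x, g (h x) = f x.

Definition injective_module E : Prop :=
  forall (A B : lmodType R) (g : {linear A -> B}) (f : {linear A -> E}),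
    injective g -> exists h : {linear B -> E}, forall x, h (g x) = f x.

Definition gen_cogen M : Prop :=
  forall N, fin_gen N -> indecomposable N ->
    projective N \/ injective_module N -> direct_summand N M.

Definition exact_at M N X (f : {linear M -> N}) (g : {linear N -> X}) : Prop :=
  forall y : N, g y = 0 <-> exists x, f x = y.

(* Exactness of  0 -> P_d -> ... -> P_1 -> P_0 -> X -> 0, where the complex is
   extended by P_i = 0 for i > d. *)
Definition proj_resolution X (d : nat) : Prop :=
  exists (P : nat -> lmodType R) (e : {linear P 0%N -> X})
         (del : forall i, {linear P i.+1 -> P i}),
    [/\ forall i, projective (P i),
        surjective e,
        exact_at (del 0%N) e,
        forall i, exact_at (del i.+1) (del i) &
        forall i, (d < i)%N -> zero_module (P i)].

Definition projdim X : enat :=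
  enat_inf [set v | exists2 d, proj_resolution X d & v = Some d].

Definition gldim : enat :=
  enat_sup [set v | exists X : lmodType R, v = projdim X].

End Modules.

(* The endomorphism ring, whose product is composition. *)
Definition endo (R : pzRingType) (M : lmodType R) := {linear M -> M}.

Section Endomorphisms.
Variables (R : pzRingType) (M : lmodType R).
Implicit Types f g h : endo M.

Lemma endoP f g : (forall x, f x = g x) -> f = g.
Proof.
move=> /funext; case: f g => [f [[addf] [scf]]] [g [[addg] [scg]]] /= fg.
case: g / fg in addg scg *.
by rewrite (Prop_irrelevance addf addg) (Prop_irrelevance scf scg).
Qed.

HB.instance Definition _ := gen_eqMixin (endo M).
HB.instance Definition _ := gen_choiceMixin (endo M).

Definition endo_zero : endo M := (\0%R : {linear M -> M}).
Definition endo_opp f : endo M := (\- f : {linear M -> M}).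
Definition endo_add f g : endo M := (f \+ g : {linear M -> M}).
Definition endo_one : endo M := (idfun : {linear M -> M}).
Definition endo_mul f g : endo M := (f \o g : {linear M -> M}).

Lemma endo_addA : associative endo_add.
Proof. by move=> f g h; apply: endoP => x /=; rewrite addrA. Qed.

Lemma endo_addC : commutative endo_add.
Proof. by move=> f g; apply: endoP => x /=; rewrite addrC. Qed.

Lemma endo_add0 : left_id endo_zero endo_add.
Proof. by move=> f; apply: endoP => x /=; rewrite add0r. Qed.

Lemma endo_addN : left_inverse endo_zero endo_opp endo_add.
Proof. by move=> f; apply: endoP => x /=; rewrite addNr. Qed.

HB.instance Definition _ :=
  GRing.isZmodule.Build (endo M) endo_addA endo_addC endo_add0 endo_addN.

Lemma endo_mulA : associative endo_mul.
Proof. by move=> f g h; apply: endoP. Qed.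

Lemma endo_mul1x : left_id endo_one endo_mul.
Proof. by move=> f; apply: endoP. Qed.

Lemma endo_mulx1 : right_id endo_one endo_mul.
Proof. by move=> f; apply: endoP. Qed.

Lemma endo_mulDl : left_distributive endo_mul +%R.
Proof. by move=> f g h; apply: endoP. Qed.

Lemma endo_mulDr : right_distributive endo_mul +%R.
Proof. by move=> f g h; apply: endoP => x; apply: raddfD. Qed.

HB.instance Definition _ := GRing.Zmodule_isPzRing.Build (endo M)
  endo_mulA endo_mul1x endo_mulx1 endo_mulDl endo_mulDr.

End Endomorphisms.

Definition repdim (R : pzRingType) : enat :=
  enat_inf [set v | exists M : lmodType R,
    [/\ fin_gen M, gen_cogen M & v = gldim (endo M)]].

(* The free algebra k<X_1, ..., X_n>, as the monoid algebra of the free monoid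
   of words in the letters 'I_n. *)
Notation free_alg k n := {malg k[{fmonom 'I_n}]}.

Section QuantumCompleteIntersection.
Variables (k : fieldType) (n : nat) (a : 'I_n -> nat) (q : 'I_n -> 'I_n -> k).

Definition free_var (i : 'I_n) : free_alg k n := << fmu i >>.

Variant qci_relator : set (free_alg k n) :=
| qci_power u : qci_relator (free_var u ^+ a u)
| qci_commutation (i j : 'I_n) : (i < j)%N ->
    qci_relator (free_var i * free_var j - q i j *: (free_var j * free_var i)).

Definition qci := quot_ring qci_relator.

HB.instance Definition _ := GRing.PzRing.on qci.

End QuantumCompleteIntersection.

(* Main.v *)
From HB Require Import structures.
Require Import Defs.
From mathcomp Require Import all_boot all_order all_algebra.
From mathcomp Require Import boolp classical_sets.
From mathcomp Require Import zify ring.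
From mathcomp Require Import finmap monalg.

Set Implicit Arguments.
Unset Strict Implicit.
Unset Printing Implicit Defensive.

Import Order.TTheory GRing.Theory Num.Theory.

Local Open Scope ring_scope.

(** Write Lambda for the algebra and, for a vector j with 0 <= j_u < a_u, put
    M_j = Lambda / (X_u^(j_u + 1) for all u).  The bound is attained on the sum
    M of the M_j.  For n = 1 this is the sum of all indecomposable modules, and
    its endomorphism algebra is the Auslander algebra of k[X]/(X^a), which has
    global dimension 2; in general A = End(M) is a twisted tensor product of n
    such algebras, one for each variable, whence the bound 2n.

    Global dimension.  The algebra A has a basis of arrows (i, m, j), where the
    generator of M_i is sent to X^m in M_j [arrow].  The product of two
    composable arrows is zero or a third arrow times a scalar, and this scalar
    is a bicharacter of the two exponents [arrow_mul].  The arrows are products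
    of projections beta_u : M_i -> M_(i - e_u) and of inclusions
    alpha_u : M_i -> M_(i + e_u), generator to X_u.  Start from the semisimple
    algebra spanned by the identities of the M_i, adjoin all the beta_u and then
    all the alpha_u, one at a time; after 2n steps this gives A.  Each step is
    an extension of B to C = B + gamma B + gamma^2 B + ..., where
    b gamma = gamma theta(b) for an endomorphism theta of B with theta(1) <> 1
    and theta^N(1) = 0.  As over a skew polynomial ring, every C-module X has a
    presentation

      0 -> C (x)_B X' -> C (x)_B X -> X -> 0,

    where X' = theta(1) X with B acting through theta, and where the first map
    sends c (x) x to c (x) gamma x - c gamma (x) x.  So a step increases the
    global dimension by at most one [skew_extension_pd_le].

    Generation and cogeneration.  The M_j with j maximal is Lambda itself.  The
    algebra is local with residue field k [aug_unit], and the coefficient of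
    the top monomial is a Frobenius form [frobenius].  A nonzero finitely
    generated projective module therefore maps onto Lambda
    [projective_retract]; a nonzero finitely generated injective module contains
    a copy of Lambda, by extension along the socle of Lambda, and the Frobenius
    form splits this copy off [injective_retract].  An indecomposable module of
    either kind is thus isomorphic to Lambda, a summand of M. *)

(** * Linear maps and kernels *)

Section LinearMaps.
Variable R : pzRingType.
Implicit Types A B E M N P Q K X Y : lmodType R.

Definition mklin M N (f : M -> N) (Hf : linear f) : {linear M -> N} :=
  HB.pack f (GRing.isLinear.Build R M N *:%R f Hf).

Lemma mklinE M N (f : M -> N) (Hf : linear f) x : mklin Hf x = f x.
Proof. by []. Qed.

Lemma linear_inj0 M N (f : {linear M -> N}) :
  (forall x, f x = 0 -> x = 0) -> injective f.
Proof.
move=> f0 x y fxy; apply/eqP; rewrite -subr_eq0; apply/eqP/f0.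
by rewrite linearB fxy subrr.
Qed.

Section Kernel.
Variables (M N : lmodType R) (g : {linear M -> N}).

Definition ker_pred : {pred M} := fun x => g x == 0.

Lemma ker_pred_submod : submod_closed ker_pred.
Proof.
split=> [|c x y]; rewrite !unfold_in ?linear0 //.
by move=> /eqP gx /eqP gy; rewrite linearP gx gy scaler0 addr0.
Qed.

HB.instance Definition _ := GRing.isSubmodClosed.Build R M ker_pred
  ker_pred_submod.

Definition kernel : Type := {x : M | x \in ker_pred}.

HB.instance Definition _ := SubType.on kernel.
HB.instance Definition _ := [Choice of kernel by <:].
HB.instance Definition _ := [SubChoice_isSubLmodule of kernel by <:].

Definition ker_incl : {linear kernel -> M} := (val : {linear kernel -> M}).

Lemma ker_incl_inj : injective ker_incl.
Proof. exact: val_inj. Qed.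

Lemma ker_incl_exact : exact_at ker_incl g.
Proof.
move=> y; split=> [gy|[x <-]]; last by apply/eqP; case: x.
have ky : y \in ker_pred by apply/eqP.
by exists (exist _ y ky).
Qed.

End Kernel.

Lemma exact_factor K M N P (f : {linear K -> M}) (g : {linear M -> N})
    (h : {linear P -> M}) :
    injective f -> exact_at f g -> (forall x, g (h x) = 0) ->
  exists h' : {linear P -> K}, forall x, f (h' x) = h x.
Proof.
move=> inj_f ex_fg gh0.
have /choice[h' h'E] x : exists y, f y = h x by apply/ex_fg.
have h'lin : linear h'.
  by move=> c x y; apply: inj_f; rewrite linearP !h'E linearP.
by exists (mklin h'lin) => x; rewrite mklinE h'E.
Qed.

Lemma bijective_of M N (f : {linear M -> N}) :
  injective f -> surjective f -> exists g : {linear N -> M}, cancel f g /\ cancel g f.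
Proof.
move=> inj_f /choice[g gK].
have glin : linear g by move=> c x y; apply: inj_f; rewrite linearP !gK.
by exists (mklin glin); split=> x; rewrite mklinE ?gK //; apply: inj_f; rewrite gK.
Qed.

(** * Projective dimension by induction on syzygies *)

(** Projective dimension at most [d], by syzygies: this form supports induction
    on [d], and no complex has to be carried along. *)
Fixpoint pd_le (d : nat) X : Prop :=
  if d is d'.+1 then
    exists (P K : lmodType R) (e : {linear P -> X}) (f : {linear K -> P}),
      [/\ projective P, surjective e, injective f, exact_at f e & pd_le d' K]
  else projective X.

Lemma projective_zero X : zero_module X -> projective X.
Proof.
move=> X0 A B g f sg; have null_lin : linear (fun _ : X => 0 : A).
  by move=> c x y; rewrite scaler0 addr0.
by exists (mklin null_lin) => x; rewrite mklinE (X0 x) !linear0.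
Qed.

Lemma projective_pair P Q : projective P -> projective Q ->
  projective (P * Q)%type.
Proof.
move=> pP pQ A B g f sg.
have f1lin : linear (fun x : P => f (x, 0)).
  by move=> c x y; rewrite -linearP; congr (f (_, _)); rewrite /= scaler0 addr0.
have f2lin : linear (fun y : Q => f (0, y)).
  by move=> c x y; rewrite -linearP; congr (f (_, _)); rewrite /= scaler0 addr0.
have [h1 h1E] := pP A B g (mklin f1lin) sg.
have [h2 h2E] := pQ A B g (mklin f2lin) sg.
have hlin : linear (fun z : P * Q => h1 z.1 + h2 z.2).
  move=> c x y /=; rewrite !linearP scalerDr addrACA //.
exists (mklin hlin) => -[x y]; rewrite mklinE linearD h1E h2E !mklinE -linearD.
by congr (f (_, _)); rewrite /= ?addr0 ?add0r.
Qed.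

Lemma projective_iso X Y (f : {linear X -> Y}) (g : {linear Y -> X}) :
  cancel g f -> projective X -> projective Y.
Proof.
move=> gK pX A B u v su.
have [h hE] := pX A B u (v \o f) su.
by exists (h \o g) => x; rewrite /= hE /= gK.
Qed.

Lemma pd_le_iso d X Y (f : {linear X -> Y}) (g : {linear Y -> X}) :
  cancel f g -> cancel g f -> pd_le d X -> pd_le d Y.
Proof.
case: d => [|d] fK gK /=; first exact: projective_iso gK.
move=> [P [K [e [i [pP se inj_i ex dK]]]]].
exists P, K, (f \o e), i; split=> //.
  by move=> y; have [x xE] := se (g y); exists x; rewrite /= xE gK.
move=> y; rewrite -ex /=; split=> [fey|->]; last by rewrite linear0.
by rewrite -[e y]fK fey linear0.
Qed.

Lemma pd_leS d X : pd_le d X -> pd_le d.+1 X.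
Proof.
elim: d X => [|d IH] X /=; last first.
  by move=> [P [K [e [i [pP se inj_i ex /IH dK]]]]]; exists P, K, e, i.
move=> pX; have kid (x : kernel (idfun : {linear X -> X})) : x = 0.
  by apply: val_inj; case: x => x /= /eqP.
exists X, (kernel (idfun : {linear X -> X})), idfun, (ker_incl _).
split=> //; [by move=> y; exists y | exact: ker_incl_inj |
  exact: ker_incl_exact | exact: projective_zero].
Qed.

(** The horseshoe construction: a lift through [g] of the projective that covers
    the quotient makes the sum of two projectives cover the middle term, and the
    syzygies again form a short exact sequence. *)
Lemma pd_le_ext d K E A (f : {linear K -> E}) (g : {linear E -> A}) :
    injective f -> exact_at f g -> surjective g ->
  pd_le d K -> pd_le d A -> pd_le d E.
Proof.
elim: d K E A f g => [|d IH] K E A f g inj_f ex sg /=.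
  move=> pK pA; have [s sE] := pA _ _ g idfun sg.
  have hlin : linear (fun z : K * A => f z.1 + s z.2).
    by move=> c x y /=; rewrite !linearP scalerDr addrACA.
  have [|e|g' [hK g'K]] := @bijective_of _ _ (mklin hlin).
  - apply: linear_inj0 => -[x y]; rewrite mklinE /= => fs0.
    have y0 : y = 0.
      have := congr1 g fs0; rewrite linearD sE linear0 (_ : g (f x) = 0) ?add0r //.
      by apply/ex; exists x.
    congr (_, _) => //; apply: inj_f; rewrite linear0.
    by move: fs0; rewrite y0 linear0 addr0.
  - have /ex[x xE] : g (e - s (g e)) = 0 by rewrite linearB sE subrr.
    by exists (x, g e); rewrite mklinE /= xE subrK.
  - by apply: (projective_iso g'K); apply: projective_pair.
move=> [P [K1 [e [i [pP se inj_i exi dK1]]]]].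
move=> [Q [A1 [e' [i' [pQ se' inj_i' exi' dA1]]]]].
have [s sE] := pQ _ _ g e' sg.
have hlin : linear (fun z : P * Q => f (e z.1) + s z.2).
  by move=> c x y /=; rewrite !linearP scalerDr addrACA.
have hE z : mklin hlin z = f (e z.1) + s z.2 by [].
have gf x : g (f x) = 0 by apply/ex; exists x.
have sh : surjective (mklin hlin).
  move=> y; have [q qE] := se' (g y).
  have /ex[x xE] : g (y - s q) = 0 by rewrite linearB sE qE subrr.
  have [p pE] := se x; exists (p, q).
  by rewrite hE pE xE subrK.
exists (P * Q)%type, (kernel (mklin hlin)), (mklin hlin), (ker_incl _).
split; [exact: projective_pair | exact: sh | exact: ker_incl_inj |
  exact: ker_incl_exact | ].
have kerE (z : kernel (mklin hlin)) : f (e (val z).1) + s (val z).2 = 0.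
  by case: z => z /= /eqP.
have in1lin : linear (fun x : K1 => (i x, 0) : P * Q).
  by move=> c x y; congr (_, _); rewrite /= ?linearP ?scaler0 ?addr0.
have [|u uE] := exact_factor (h := mklin in1lin) (@ker_incl_inj _ _ _)
  (@ker_incl_exact _ _ (mklin hlin)).
  move=> x; rewrite hE mklinE /= linear0 addr0.
  by rewrite (_ : e (i x) = 0) ?linear0 //; apply/exi; exists x.
have pr2lin : linear (fun z : kernel (mklin hlin) => (val z).2).
  by move=> c x y; rewrite !linearP.
have pr2E z : e' (val (z : kernel (mklin hlin))).2 = 0.
  have := congr1 g (kerE z); rewrite linear0 linearD gf add0r sE //.
have [v vE] := exact_factor (h := mklin pr2lin) inj_i' exi' pr2E.
apply: (IH K1 _ A1 u v _ _ _ dK1 dA1).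
- apply: linear_inj0 => x ux0; apply: inj_i; rewrite linear0.
  by have := uE x; rewrite ux0 linear0 => -[].
- move=> z; split=> [vz0|[x <-]]; last first.
    by apply: inj_i'; rewrite vE linear0 mklinE -[val _]/(ker_incl _ _) uE.
  have z2 : (val z).2 = 0 by rewrite -[LHS](mklinE pr2lin) -vE vz0 linear0.
  have /exi[x xE] : e (val z).1 = 0.
    apply: inj_f; rewrite linear0; have := kerE z.
    by rewrite z2 linear0 addr0.
  exists x; apply: val_inj; rewrite -[val (u x)]/(ker_incl _ _) uE mklinE xE.
  by rewrite -z2; case: (val z).
- move=> y; have e'y : e' (i' y) = 0 by apply/exi'; exists y.
  have /ex[x xE] : g (s (i' y)) = 0 by rewrite sE.
  have [p pE] := se x.
  have [|z zE] := (ker_incl_exact (mklin hlin) (- p, i' y)).1.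
    by rewrite hE /= !linearN pE xE addNr.
  by exists z; apply: inj_i'; rewrite vE mklinE -[val z]/(ker_incl _ z) zE.
Qed.

(** If P covers B with kernel K, then P also covers X, with a kernel that is an
    extension of A by K. *)
Lemma pd_le_coker d A B X (f : {linear A -> B}) (g : {linear B -> X}) :
    injective f -> exact_at f g -> surjective g ->
  pd_le d A -> pd_le d B -> pd_le d.+1 X.
Proof.
case: d => [|d] inj_f ex sg dA; first by exists B, A, g, f.
move=> [P [K [e [i [pP se inj_i exi dK]]]]].
exists P, (kernel (g \o e)), (g \o e), (ker_incl _); split=> //.
- by move=> x; have [y <-] := sg x; have [p <-] := se y; exists p.
- exact: ker_incl_inj.
- exact: ker_incl_exact.
have [|u uE] := exact_factor (h := i) (@ker_incl_inj _ _ _)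
  (@ker_incl_exact _ _ (g \o e)).
  by move=> x /=; rewrite (_ : e (i x) = 0) ?linear0 //; apply/exi; exists x.
have elin : linear (fun z : kernel (g \o e) => e (val z)).
  by move=> c x y; rewrite !linearP.
have geE z : g (e (val (z : kernel (g \o e)))) = 0 by case: z => z /= /eqP.
have [v vE] := exact_factor (h := mklin elin) inj_f ex geE.
apply: (pd_le_ext (f := u) (g := v) _ _ _ (pd_leS dK) dA).
- by move=> x y uxy; apply: inj_i; rewrite -!uE uxy.
- move=> z; split=> [vz0|[x <-]]; last first.
    apply: inj_f; rewrite vE linear0 mklinE -[val _]/(ker_incl _ _) uE.
    by apply/exi; exists x.
  have /exi[x xE] : e (val z) = 0 by rewrite -[LHS](mklinE elin) -vE vz0 linear0.
  by exists x; apply: val_inj; rewrite -[val (u x)]/(ker_incl _ _) uE.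
- move=> a; have [p pE] := se (f a).
  have [|z zE] := (ker_incl_exact (g \o e) p).1.
    by rewrite /= pE; apply/ex; exists a.
  by exists z; apply: inj_f; rewrite vE mklinE -[val z]/(ker_incl _ z) zE.
Qed.

(** The short exact sequences of syzygies are spliced into one complex. *)
Lemma pd_le_resolution d X : pd_le d X -> proj_resolution X d.
Proof.
elim: d X => [|d IH] X /=.
  move=> pX; pose Z := kernel (idfun : {linear X -> X}).
  have Z0 (x : Z) : x = 0 by apply: val_inj; case: x => x /= /eqP.
  pose P i : lmodType R := if i is 0%N then X else Z.
  pose del i : {linear P i.+1 -> P i} := (\0%R : {linear P i.+1 -> P i}).
  exists P, (idfun : {linear P 0%N -> X}), del; split=> //.
  - by case=> [|i] //=; apply: projective_zero.
  - by move=> y; exists y.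
  - by move=> y; split=> [/= ->|[x <-]] //; exists 0.
  - move=> i y; split=> [_|[x <-]]; last by [].
    by exists 0; rewrite linear0 (Z0 y).
  - by case.
move=> [P0 [K [e [f [pP se inj_f ex /IH]]]]].
move=> [P [e' [del [pPi se' ex0 exi z]]]].
pose Q i : lmodType R := if i is j.+1 then P j else P0.
pose dQ i : {linear Q i.+1 -> Q i} :=
  match i return {linear Q i.+1 -> Q i} with
  | 0%N => (f \o e' : {linear P 0%N -> P0})
  | j.+1 => del j
  end.
exists Q, (e : {linear Q 0%N -> X}), dQ; split=> //.
- by case.
- move=> y; rewrite ex; split=> [[x <-]|[x <-]]; last by exists (e' x).
  by have [w <-] := se' x; exists w.
- case=> [|i] /=; last exact: exi.
  move=> y; rewrite -ex0; split=> [/= fe0|/= ->]; last by rewrite linear0.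
  by apply: inj_f; rewrite fe0 linear0.
- by case=> [//|i]; rewrite ltnS => /z.
Qed.

Lemma gldim_le d : (forall X, pd_le d X) -> leqe (gldim R) (Some d).
Proof.
move=> pd; apply/enat_sup_lub => _ [X ->].
have : leqe (projdim X) (projdim X) by case: (projdim X) => /=.
move=> /enat_inf_glb; apply; exists d => //.
exact/pd_le_resolution/pd.
Qed.

End LinearMaps.

(** * Unital part of a nonunital action *)

(** The unit of R need not act as the identity: the modules below arise by
    cutting a simple group down to the image of the idempotent [rho 1]. *)
Record action (R : pzRingType) (V : zmodType) := Action {
  act :> R -> V -> V;
  actDl : forall r s v, act (r + s) v = act r v + act s v;
  actDr : forall r v w, act r (v + w) = act r v + act r w;
  actM : forall r s v, act (r * s) v = act r (act s v) }.

Section Action.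
Variables (R : pzRingType) (V : zmodType) (rho : action R V).

Lemma act0r r : rho r 0 = 0.
Proof. by apply: (addrI (rho r 0)); rewrite -actDr !addr0. Qed.

Lemma actNr r v : rho r (- v) = - rho r v.
Proof. by apply: (addrI (rho r v)); rewrite -actDr !subrr act0r. Qed.

Definition unital_pred : {pred V} := fun v => rho 1 v == v.

Lemma unital_pred_zmod : zmod_closed unital_pred.
Proof.
split=> [|x y]; rewrite !unfold_in ?act0r //.
by move=> /eqP xE /eqP yE; rewrite actDr actNr xE yE.
Qed.

HB.instance Definition _ := GRing.isZmodClosed.Build V unital_pred
  unital_pred_zmod.

Definition unital_part : Type := {v : V | v \in unital_pred}.

HB.instance Definition _ := SubType.on unital_part.
HB.instance Definition _ := [Choice of unital_part by <:].
HB.instance Definition _ := [SubChoice_isSubZmodule of unital_part by <:].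

Lemma unital_act r v : rho r v \in unital_pred.
Proof. by rewrite unfold_in -actM mul1r. Qed.

Definition mk_unital v (hv : v \in unital_pred) : unital_part := exist _ v hv.

Definition unital_of r v : unital_part := mk_unital (unital_act r v).

Definition unital_scale r (x : unital_part) : unital_part :=
  unital_of r (val x).

Lemma unitalK (x : unital_part) : rho 1 (val x) = val x.
Proof. by apply/eqP; case: x. Qed.

Lemma unital_scaleA a b v :
  unital_scale a (unital_scale b v) = unital_scale (a * b) v.
Proof. by apply: val_inj; rewrite /= actM. Qed.

Lemma unital_scale1 : left_id 1 unital_scale.
Proof. by move=> v; apply: val_inj; rewrite /= unitalK. Qed.

Lemma unital_scaleDr : right_distributive unital_scale +%R.
Proof. by move=> r v w; apply: val_inj; rewrite /= actDr. Qed.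

Lemma unital_scaleDl v : {morph unital_scale^~ v : a b / a + b}.
Proof. by move=> r s; apply: val_inj; rewrite /= actDl. Qed.

HB.instance Definition _ := GRing.Zmodule_isLmodule.Build R unital_part
  unital_scaleA unital_scale1 unital_scaleDr unital_scaleDl.

Lemma unital_valZ r (x : unital_part) : val (r *: x) = rho r (val x).
Proof. by []. Qed.

End Action.

(** * Induction along a ring extension with a dual basis *)

(** The map [iota] occurs in the type so that the B-module structure can be
    inferred from it. *)
Definition res (B C : pzRingType) (iota : {rmorphism B -> C}) (X : lmodType C) :
  Type := X.

Section Induction.
Variables (B C : pzRingType) (iota : {rmorphism B -> C}).

Section Restriction.
Variable X : lmodType C.

Local Notation res := (res iota X).

HB.instance Definition _ := GRing.Zmodule.on res.

Definition res_scale r (v : res) : res := iota r *: (v : X).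

Lemma res_scaleA a b v : res_scale a (res_scale b v) = res_scale (a * b) v.
Proof. by rewrite /res_scale rmorphM scalerA. Qed.

Lemma res_scale1 : left_id 1 res_scale.
Proof. by move=> v; rewrite /res_scale rmorph1 scale1r. Qed.

Lemma res_scaleDr : right_distributive res_scale +%R.
Proof. by move=> r v w; apply: scalerDr. Qed.

Lemma res_scaleDl v : {morph res_scale^~ v : a b / a + b}.
Proof. by move=> r s; rewrite /res_scale rmorphD scalerDl. Qed.

HB.instance Definition _ := GRing.Zmodule_isLmodule.Build B res
  res_scaleA res_scale1 res_scaleDr res_scaleDl.

End Restriction.

Lemma resE (X : lmodType C) r (v : res iota X) : r *: v = iota r *: (v : X).
Proof. by []. Qed.

(** Here [(g, phi)] is a dual basis of C as a right B-module. *)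
Variables (N : nat) (g : 'I_N -> C) (phi : 'I_N -> C -> B).
Hypothesis phiD : forall p c d, phi p (c + d) = phi p c + phi p d.
Hypothesis phiM : forall p c b, phi p (c * iota b) = phi p c * b.
Hypothesis phiE : forall c, \sum_p g p * iota (phi p c) = c.

Lemma dual0 p : phi p 0 = 0.
Proof. by apply: (addrI (phi p 0)); rewrite -phiD !addr0. Qed.

Lemma dual_sum p (I : Type) (s : seq I) (P : pred I) (F : I -> C) :
  phi p (\sum_(i <- s | P i) F i) = \sum_(i <- s | P i) phi p (F i).
Proof. by apply: (big_morph (phi p)) => [v w|]; [exact: phiD|exact: dual0]. Qed.

Section Module.
Variable X : lmodType B.

Definition ind_act (c : C) (x : {ffun 'I_N -> X}) : {ffun 'I_N -> X} :=
  [ffun q => \sum_p phi q (c * g p) *: x p].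

Lemma ind_actDl r s v : ind_act (r + s) v = ind_act r v + ind_act s v.
Proof.
apply/ffunP=> q; rewrite !ffunE -big_split; apply: eq_bigr => p _.
by rewrite mulrDl phiD scalerDl.
Qed.

Lemma ind_actDr r v w : ind_act r (v + w) = ind_act r v + ind_act r w.
Proof.
apply/ffunP=> q; rewrite !ffunE -big_split; apply: eq_bigr => p _.
by rewrite ffunE scalerDr.
Qed.

Lemma ind_actM r s v : ind_act (r * s) v = ind_act r (ind_act s v).
Proof.
apply/ffunP=> q; rewrite !ffunE.
under [RHS]eq_bigr => p _ do rewrite ffunE scaler_sumr.
rewrite exchange_big; apply: eq_bigr => p _ /=.
under eq_bigr => t _ do rewrite scalerA -phiM -mulrA.
by rewrite -scaler_suml -dual_sum -mulr_sumr phiE mulrA.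
Qed.

Definition ind_action := Action ind_actDl ind_actDr ind_actM.

(** The tensor product of C and X over B: the family [x] stands for the sum of
    the g_p (x) x_p.  The g_p may satisfy relations; the coordinates are made
    unique by requiring that x_q = \sum_p phi_q(g_p) x_p. *)
Definition ind : lmodType C := unital_part ind_action.

Lemma indP (c : C) (x : ind) q :
  val (c *: x) q = \sum_p phi q (c * g p) *: val x p.
Proof. by rewrite unital_valZ ffunE. Qed.

Lemma indD (x y : ind) q : val (x + y) q = val x q + val y q.
Proof. by rewrite [LHS]ffunE. Qed.

Lemma ind1 (x : ind) q : \sum_p phi q (g p) *: val x p = val x q.
Proof.
rewrite -[in RHS](unitalK x) [RHS]ffunE; apply: eq_bigr => p _.
by rewrite mul1r.
Qed.

Definition ind_unit_fun (x : X) : {ffun 'I_N -> X} := [ffun q => phi q 1 *: x].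

Lemma ind_unit_subproof x : ind_unit_fun x \in unital_pred ind_action.
Proof.
rewrite unfold_in; apply/eqP/ffunP=> q; rewrite !ffunE.
under eq_bigr => p _ do rewrite ffunE mul1r scalerA -phiM.
by rewrite -scaler_suml -dual_sum phiE.
Qed.

Definition ind_unit x : ind := mk_unital (ind_unit_subproof x).

Lemma ind_unitE x q : val (ind_unit x) q = phi q 1 *: x.
Proof. by rewrite ffunE. Qed.

Lemma ind_unitD x y : ind_unit (x + y) = ind_unit x + ind_unit y.
Proof.
apply: val_inj; apply/ffunP=> q.
by rewrite indD !ind_unitE scalerDr.
Qed.

Lemma ind_unitZ b x : ind_unit (b *: x) = iota b *: ind_unit x.
Proof.
apply: val_inj; apply/ffunP=> q; rewrite indP ind_unitE.
under eq_bigr => p _ do rewrite ind_unitE scalerA -phiM -mulrA.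
by rewrite -scaler_suml -dual_sum -mulr_sumr phiE mulr1 scalerA -phiM mul1r.
Qed.

Lemma ind_sumE (x : ind) : \sum_p g p *: ind_unit (val x p) = x.
Proof.
apply: val_inj; apply/ffunP=> q; rewrite -[RHS]ind1.
rewrite (raddf_sum (val : {additive ind -> _})) sum_ffunE.
apply: eq_bigr => p _; rewrite indP.
under eq_bigr => t _ do rewrite ind_unitE scalerA -phiM -mulrA.
by rewrite -scaler_suml -dual_sum -mulr_sumr phiE mulr1.
Qed.

End Module.

Lemma ind_lift (X : lmodType B) (Y : lmodType C)
    (h : X -> Y) (hD : forall x y, h (x + y) = h x + h y)
    (hZ : forall b x, h (b *: x) = iota b *: h x) :
  linear (fun x : ind X => \sum_p g p *: h (val x p)).
Proof.
have h0 : h 0 = 0 by apply: (addrI (h 0)); rewrite -hD !addr0.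
move=> c x y; under eq_bigr => p _ do
  rewrite indD indP hD (big_morph h hD h0) scalerDr scaler_sumr.
rewrite big_split /=; congr (_ + _).
rewrite exchange_big scaler_sumr; apply: eq_bigr => p _ /=.
under eq_bigr => t _ do rewrite hZ scalerA.
by rewrite -scaler_suml phiE scalerA.
Qed.

(** Induction is left adjoint to restriction, which preserves surjections. *)
Lemma ind_projective (P : lmodType B) : projective P -> projective (ind P).
Proof.
move=> pP A Y u f su.
have f'lin : linear (fun x : P => f (ind_unit x) : res iota Y).
  by move=> b x y; rewrite ind_unitD ind_unitZ linearP.
have u'lin : linear (fun x : res iota A => u x : res iota Y).
  by move=> b x y; rewrite linearP.
have [h hE] := pP _ _ (mklin u'lin) (mklin f'lin) su.
have hD x y : (h (x + y) : A) = (h x : A) + h y by rewrite linearD.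
have hZ b x : (h (b *: x) : A) = iota b *: (h x : A) by rewrite linearZ.
exists (mklin (@ind_lift P A h hD hZ)) => x; rewrite mklinE linear_sum.
rewrite -[in RHS](ind_sumE x) linear_sum; apply: eq_bigr => p _.
by rewrite !linearZ /=; congr (_ *: _); apply: hE.
Qed.

Section Functor.
Variables (X Y : lmodType B) (f : {linear X -> Y}).

Lemma ind_map_subproof (x : ind X) :
  [ffun q => f (val x q)] \in unital_pred (ind_action Y).
Proof.
rewrite unfold_in; apply/eqP/ffunP=> q; rewrite !ffunE -[in RHS]ind1 linear_sum.
by apply: eq_bigr => p _; rewrite ffunE mul1r linearZ.
Qed.

Definition ind_map_fun (x : ind X) : ind Y := mk_unital (ind_map_subproof x).

Lemma ind_map_funE x q : val (ind_map_fun x) q = f (val x q).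
Proof. by rewrite ffunE. Qed.

Lemma ind_map_linear : linear ind_map_fun.
Proof.
move=> c x y; apply: val_inj; apply/ffunP=> q.
rewrite indD indP !ind_map_funE indD indP linearD linear_sum.
by congr (_ + _); apply: eq_bigr => p _; rewrite linearZ ind_map_funE.
Qed.

Definition ind_map : {linear ind X -> ind Y} := mklin ind_map_linear.

Lemma ind_mapE x q : val (ind_map x) q = f (val x q).
Proof. by rewrite ffunE. Qed.

End Functor.

(** Induction is exact since coordinates are taken componentwise, so it maps
    the syzygy sequences over B to syzygy sequences over C. *)
Lemma ind_pd_le d (X : lmodType B) : pd_le d X -> pd_le d (ind X).
Proof.
elim: d X => [|d IH] X /=; first exact: ind_projective.
move=> [P [K [e [f [pP se inj_f ex dK]]]]].
exists (ind P), (ind K), (ind_map e), (ind_map f); split; last exact: IH.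
- exact: ind_projective.
- move=> y; have /choice[s sE] q := se (val y q).
  pose z : {ffun 'I_N -> P} := [ffun q => s q].
  exists (unital_of (ind_action P) 1 z).
  apply: val_inj; apply/ffunP=> q; rewrite ind_mapE ffunE linear_sum -ind1.
  by apply: eq_bigr => p _; rewrite linearZ ffunE sE mul1r.
- move=> x y fxy; apply: val_inj; apply/ffunP=> q; apply: inj_f.
  by rewrite -!ind_mapE fxy.
- move=> y; split=> [ey|[x <-]]; last first.
    apply: val_inj; apply/ffunP=> q; rewrite !ind_mapE [RHS]ffunE.
    by apply/ex; exists (val x q).
  have /choice[s sE] q : exists x, f x = val y q.
    by apply/ex; rewrite -ind_mapE ey ffunE.
  have zu : [ffun q => s q] \in unital_pred (ind_action K).
    rewrite unfold_in; apply/eqP/ffunP=> q; apply: inj_f; rewrite !ffunE sE.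
    rewrite linear_sum -ind1.
    by apply: eq_bigr => p _; rewrite linearZ ffunE sE mul1r.
  exists (mk_unital zu); apply: val_inj; apply/ffunP=> q.
  by rewrite ind_mapE ffunE sE.
Qed.

End Induction.

(** * Truncated skew polynomial extensions *)

Lemma pd_le_ring_iso (B C : pzRingType) (iota : {rmorphism B -> C}) d :
    bijective iota ->
  (forall Y : lmodType B, pd_le d Y) -> forall X : lmodType C, pd_le d X.
Proof.
case=> inv iotaK invK pdB X.
pose g (_ : 'I_1) : C := 1; pose phi (_ : 'I_1) := inv.
have inj := can_inj iotaK.
have phiD p c e : phi p (c + e) = phi p c + phi p e.
  by apply: inj; rewrite rmorphD !invK.
have phiM p c b : phi p (c * iota b) = phi p c * b.
  by apply: inj; rewrite rmorphM !invK.
have phiE c : \sum_p g p * iota (phi p c) = c.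
  by rewrite big_ord1 mul1r invK.
have : pd_le d (ind phiD phiM phiE (res iota X)) by apply: ind_pd_le.
have hD (x y : res iota X) : (x + y : X) = (x : X) + y by [].
have hZ b (x : res iota X) : (b *: x : res iota X) = iota b *: (x : X) by [].
have flin := @ind_lift _ _ _ _ _ _ phiD phiM phiE _ _ _ hD hZ.
have [||f [fK f'K]] := @bijective_of _ _ _ (mklin flin); last exact: pd_le_iso fK f'K.
- apply: linear_inj0 => x; rewrite mklinE big_ord1 scale1r => x0.
  by apply: val_inj; apply/ffunP=> q; rewrite ord1 x0 ffunE.
- move=> y; exists (ind_unit phiD phiM phiE (y : res iota X)).
  by rewrite mklinE big_ord1 scale1r ind_unitE resE invK scale1r.
Qed.

(** The ring C is the sum of the gam^p theta^p(1) B over p < N, freely in the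
    sense that [phi] gives well-defined coordinates. *)
Section SkewExtension.
Variables (B C : pzRingType) (iota : {rmorphism B -> C}).
Variables (gam : C) (theta : B -> B) (N : nat) (phi : 'I_N -> C -> B).

Hypothesis phiD : forall p c d, phi p (c + d) = phi p c + phi p d.
Hypothesis phiM : forall p c b, phi p (c * iota b) = phi p c * b.
Hypothesis phiE : forall c, \sum_(p < N) gam ^+ p * iota (phi p c) = c.
Hypothesis phi_exp :
  forall (q : 'I_N) p, phi q (gam ^+ p) = if p == q then iter p theta 1 else 0.
Hypothesis thetaD : forall b c, theta (b + c) = theta b + theta c.
Hypothesis thetaM : forall b c, theta (b * c) = theta b * theta c.
Hypothesis theta_gam : forall b, iota b * gam = gam * iota (theta b).
Hypothesis theta_nil : iter N theta 1 = 0.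

Let g (p : 'I_N) : C := gam ^+ p.
Let phiE' c : \sum_p g p * iota (phi p c) = c := phiE c.
Let Ind := ind phiD phiM phiE'.

Lemma theta_gamX b m : iota b * gam ^+ m = gam ^+ m * iota (iter m theta b).
Proof.
elim: m b => [|m IH] b; first by rewrite expr0 mulr1 mul1r.
by rewrite exprS mulrA theta_gam -mulrA IH mulrA -iterSr.
Qed.

Section Module.
Variable X : lmodType C.

(** The module X' of the presentation: [theta 1] need not be 1, so that the
    action has to be cut down to its unital part. *)
Definition shift_act (b : B) (x : X) := iota (theta b) *: x.

Lemma shift_actDl r s v : shift_act (r + s) v = shift_act r v + shift_act s v.
Proof. by rewrite /shift_act thetaD rmorphD scalerDl. Qed.

Lemma shift_actDr r v w : shift_act r (v + w) = shift_act r v + shift_act r w.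
Proof. exact: scalerDr. Qed.

Lemma shift_actM r s v : shift_act (r * s) v = shift_act r (shift_act s v).
Proof. by rewrite /shift_act thetaM rmorphM scalerA. Qed.

Definition shift_action := Action shift_actDl shift_actDr shift_actM.

Definition shifted : lmodType B := unital_part shift_action.

Definition extz (x : {ffun 'I_N -> X}) (p : nat) : X :=
  if insub p is Some i then x i else 0.

Lemma extzE x (i : 'I_N) : extz x i = x i.
Proof. by rewrite /extz valK. Qed.

Lemma extz_out x p : (N <= p)%N -> extz x p = 0.
Proof. by move=> Np; rewrite /extz insubN // -leqNgt. Qed.

Definition coords (y : Ind shifted) : {ffun 'I_N -> res iota X} :=
  [ffun q => val (val y q)].

Lemma coordsE y q : coords y q = val (val y q).
Proof. by rewrite ffunE. Qed.

Let act := ind_action phiD phiM phiE' (res iota X).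

Definition gcoords (y : Ind shifted) : {ffun 'I_N -> res iota X} :=
  [ffun q => gam *: (coords y q : X)].

(** The map c (x) x |-> c (x) gam x - c gam (x) x, written with the actions of 1
    and of [gam] so that its values are unital by construction. *)
Definition koszul_fun (y : Ind shifted) : Ind (res iota X) :=
  unital_of act 1 (gcoords y) - unital_of act gam (coords y).

Lemma coordsD x y : coords (x + y) = coords x + coords y.
Proof. by apply/ffunP=> q; rewrite [RHS]ffunE !coordsE indD. Qed.

Lemma coordsDE x y q :
  (coords (x + y) q : X) = (coords x q : X) + (coords y q : X).
Proof. by rewrite coordsD ffunE. Qed.

Lemma coordsZ c y q :
  (coords (c *: y) q : X) =
    \sum_p iota (theta (phi q (c * g p))) *: (coords y p : X).
Proof.
rewrite coordsE indP (raddf_sum (val : {additive shifted -> _})).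
by apply: eq_bigr => p _; rewrite coordsE.
Qed.

Lemma gcoordsE y q : gcoords y q = gam *: (coords y q : X).
Proof. by rewrite ffunE. Qed.

Lemma koszul_linear : linear koszul_fun.
Proof.
have actE c (v : {ffun 'I_N -> res iota X}) q :
    (act c v q : X) = \sum_p iota (phi q (c * g p)) *: (v p : X).
  by rewrite ffunE.
have eqZ c (y : Ind shifted) : koszul_fun (c *: y) = c *: koszul_fun y.
  rewrite scalerBr; congr (_ - _); apply: val_inj.
    rewrite unital_valZ -[RHS](@actM _ _ act) mulr1; apply/ffunP=> q.
    rewrite [LHS]actE [RHS]actE.
    under eq_bigr => p _ do rewrite gcoordsE coordsZ !scaler_sumr.
    rewrite exchange_big; apply: eq_bigr => p _ /=.
    under eq_bigr => t _ do rewrite !scalerA -mulrA -theta_gam mulrA -rmorphM -phiM mul1r.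
    by rewrite gcoordsE -scaler_suml -mulr_suml -rmorph_sum -dual_sum // phiE' scalerA.
  rewrite unital_valZ -[RHS](@actM _ _ act); apply/ffunP=> q.
  rewrite [LHS]actE [RHS]actE.
  under eq_bigr => p _ do rewrite coordsZ scaler_sumr.
  rewrite exchange_big; apply: eq_bigr => p _ /=.
  under eq_bigr => t _ do
    rewrite scalerA -rmorphM -phiM -exprS exprSr -mulrA -theta_gam mulrA.
  rewrite -scaler_suml -rmorph_sum -dual_sum // -mulr_suml phiE'.
  by rewrite -!mulrA -exprSr -exprS.
have eqD x y : koszul_fun (x + y) = koszul_fun x + koszul_fun y.
  rewrite [RHS]addrACA -opprD; congr (_ - _); apply: val_inj.
    rewrite [LHS]/= [RHS]/= -(@actDr _ _ act); congr (act _ _).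
    apply/ffunP=> q; rewrite [RHS]ffunE !gcoordsE coordsDE.
    exact: (@scalerDr _ X).
  by rewrite [LHS]/= [RHS]/= -(@actDr _ _ act) coordsD.
by move=> c x y; rewrite eqD eqZ.
Qed.

Definition koszul : {linear Ind shifted -> Ind (res iota X)} :=
  mklin koszul_linear.

Let idD (x y : res iota X) : (x + y : X) = (x : X) + y.
Proof. by []. Qed.

Let idZ b (x : res iota X) : (b *: x : res iota X) = iota b *: (x : X).
Proof. by []. Qed.

Definition counit : {linear Ind (res iota X) -> X} :=
  mklin (@ind_lift _ _ _ _ _ _ phiD phiM phiE' _ _ _ idD idZ).

Lemma counitE x : counit x = \sum_(p < N) gam ^+ p *: (val x p : X).
Proof. by []. Qed.

Lemma counit_surj : surjective counit.
Proof.
move=> y; exists (ind_unit phiD phiM phiE' (y : res iota X)).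
rewrite counitE; under eq_bigr => p _ do rewrite ind_unitE resE scalerA.
by rewrite -scaler_suml phiE scale1r.
Qed.

Lemma sum_phi (M : lmodType B) (F : 'I_N -> M) (q : 'I_N) :
  \sum_p phi q (g p) *: F p = iter q theta 1 *: F q.
Proof.
rewrite (bigD1 q) //= phi_exp eqxx big1 ?addr0 // => p npq.
by rewrite phi_exp -[_ == _ :> nat]/(p == q) (negPf npq) scale0r.
Qed.

Lemma coords_idem (y : Ind shifted) (q : 'I_N) :
  iota (iter q.+1 theta 1) *: (coords y q : X) = coords y q.
Proof. by rewrite coordsE -[in RHS]ind1 sum_phi. Qed.

(** Since C is free over B on the powers of [gam], the coordinate of index q is
    gam y_q - y_(q - 1), as for the multiplication by gam - t on polynomials. *)
Lemma koszulE y (q : 'I_N) :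
  (val (koszul y) q : X) =
    gam *: (coords y q : X) - (if val q is q'.+1 then extz (coords y) q' else 0).
Proof.
rewrite mklinE indD ffunE; congr (_ + _).
  under eq_bigr => p _ do rewrite mul1r.
  rewrite sum_phi resE gcoordsE scalerA theta_gam -scalerA.
  by rewrite -[theta _]iterS coords_idem.
rewrite ffunE ffunE; congr (- _).
under eq_bigr => p _ do rewrite -exprS phi_exp.
case: q => -[|q'] q'N /=.
  by rewrite big1 // => p _; rewrite scale0r.
have q'N' := ltnW q'N.
rewrite (bigD1 (Ordinal q'N')) //= eqSS eqxx big1 ?addr0 => [|p npq].
  by rewrite resE (coords_idem y (Ordinal q'N')) -(extzE (coords y) (Ordinal q'N')).
rewrite eqSS; case: eqP => [pq|]; last by rewrite scale0r.
by case/eqP: npq; apply: val_inj.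
Qed.

(** By descending induction on the index, as y_N = 0 and
    y_(q - 1) = gam y_q. *)
Lemma koszul_inj : injective koszul.
Proof.
apply: linear_inj0 => y y0.
have stepE p : (p.+1 < N)%N -> extz (coords y) p = gam *: extz (coords y) p.+1.
  move=> pN; have := koszulE y (Ordinal pN); rewrite y0 ffunE /=.
  by move=> /esym/eqP; rewrite subr_eq0 -(extzE (coords y) (Ordinal pN)) => /eqP.
have ext0 d p : (N <= p + d)%N -> extz (coords y) p = 0.
  elim: d p => [|d IH] p; first by rewrite addn0; apply: extz_out.
  rewrite addnS => Npd; have [pN|Np] := ltnP p N; last exact: extz_out.
  have [p1N|Np1] := ltnP p.+1 N; first by rewrite stepE // IH ?scaler0.
  have NE : p.+1 = N by apply/eqP; rewrite eqn_leq Np1 pN.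
  have thp0 : iter p.+1 theta 1 = 0 by rewrite NE.
  rewrite (extzE (coords y) (Ordinal pN)) -(coords_idem y (Ordinal pN)).
  by rewrite [iter _ _ _]thp0 rmorph0 scale0r.
apply: val_inj; apply/ffunP=> q; apply: val_inj.
by rewrite ffunE -coordsE -(extzE (coords y) q) (ext0 N) ?leq_addl.
Qed.

(** A relation \sum_q gam^q x_q = 0 is divided by gam - t with the Horner scheme:
    the coefficients of the quotient are the opposites of the tails
    S (q + 1) = \sum_(r > q) gam^(r - q - 1) x_r. *)
Lemma koszul_exact : exact_at koszul counit.
Proof.
have counit_unital c (v : {ffun 'I_N -> res iota X}) :
    counit (unital_of act c v) = \sum_(p < N) (c * g p) *: (v p : X).
  rewrite counitE.
  under eq_bigr => p _ do rewrite ffunE scaler_sumr.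
  rewrite exchange_big; apply: eq_bigr => p _ /=.
  by under eq_bigr => t _ do rewrite resE scalerA; rewrite -scaler_suml phiE.
move=> x; split=> [x0|[y <-]]; last first.
  rewrite [koszul y]mklinE linearB !counit_unital -sumrB big1 // => p _.
  by rewrite gcoordsE scalerA mul1r -exprS exprSr subrr.
pose S q : X := \sum_(r < N | (q <= r)%N) gam ^+ (r - q) *: (val x r : X).
have S0 : S 0%N = 0.
  by rewrite -[RHS]x0 counitE /S; apply: eq_bigr => r _; rewrite subn0.
have SS (q : 'I_N) : S q = val x q + gam *: S q.+1.
  rewrite /S (bigD1 q) //= subnn scale1r; congr (_ + _).
  rewrite scaler_sumr; apply: eq_big => [r|r /andP[qr nrq]].
    by rewrite [in RHS]ltn_neqAle andbC eq_sym.
  have {qr nrq} qr : (q < r)%N.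
    by rewrite ltn_neqAle qr andbT; apply: contraNneq nrq => /val_inj ->.
  by rewrite scalerA -exprS subnSK.
have x_idem (r : 'I_N) : iota (iter r theta 1) *: (val x r : X) = val x r.
  by rewrite -[in RHS]ind1 sum_phi.
have S_idem q : iota (iter q theta 1) *: S q = S q.
  rewrite scaler_sumr; apply: eq_bigr => r qr.
  by rewrite scalerA theta_gamX -iterD subnK // -scalerA x_idem.
have yu q : - S q.+1 \in unital_pred shift_action.
  rewrite unfold_in; apply/eqP; rewrite actNr; congr (- _).
  rewrite -[in LHS](S_idem q.+1) /= /shift_act scalerA -rmorphM -thetaM mul1r.
  exact: (S_idem q.+1).
pose yf : {ffun 'I_N -> shifted} := [ffun q => mk_unital (yu (val q))].
have yfu : yf \in unital_pred (ind_action phiD phiM phiE' shifted).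
  rewrite unfold_in; apply/eqP/ffunP=> q; rewrite ffunE.
  under eq_bigr => p _ do rewrite mul1r.
  rewrite sum_phi ffunE; apply: val_inj; rewrite /= /shift_act scalerN.
  by rewrite (S_idem q.+1).
exists (mk_unital yfu); apply: val_inj; apply/ffunP=> q; rewrite koszulE.
have cE (p : 'I_N) : (coords (mk_unital yfu) p : X) = - S p.+1.
  by rewrite coordsE /= ffunE.
rewrite cE scalerN; have := SS q.
case: q => -[|q'] q'N /=; first by rewrite S0 subr0 => /esym/eqP; rewrite addr_eq0 => /eqP ->.
move=> SqE; have q'N' := ltnW q'N.
rewrite -[q' in extz _ q']/(val (Ordinal q'N')) extzE cE opprK [S (val _).+1]SqE.
by rewrite addrC addrK.
Qed.

End Module.

Lemma skew_extension_pd_le d : (forall Y : lmodType B, pd_le d Y) ->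
  forall X : lmodType C, pd_le d.+1 X.
Proof.
move=> pdB X.
apply: (pd_le_coker (@koszul_inj X) (@koszul_exact X) (@counit_surj X)).
  exact: ind_pd_le.
exact: ind_pd_le.
Qed.

End SkewExtension.

(** * Semisimple rings *)

(** The hypothesis says that R is the sum of left ideals R e that are simple. *)
Section Semisimple.
Variables (R : pzRingType) (s : seq R).
Hypothesis sum_s : \sum_(e <- s) e = 1.
Hypothesis minimal_s :
  forall e z, e \in s -> z * e = 0 \/ exists w, w * (z * e) = e.

Section Splitting.
Variables (A X : lmodType R) (g : {linear A -> X}).
Hypothesis sg : surjective g.

(** The graph of a linear section of [g] over some submodule of X. *)
Definition partial_section (H : set (X * A)) : Prop :=
  [/\ forall z, H z -> g z.2 = z.1,
      forall (c : R) z w, H z -> H w -> H (c *: z + w) &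
      forall z, H z -> z.1 = 0 -> z.2 = 0].

(* Zorn's lemma is applied to graphs without their element 0, so that the union
   of the empty chain is admissible. *)
Local Notation add0 H := ([set 0] `|` H)%classic.

Lemma partial_section_chain (F : set (set (X * A))) :
    (F `<=` [set H | partial_section (add0 H)])%classic ->
    total_on F subset ->
  partial_section (add0 (\bigcup_(H in F) H))%classic.
Proof.
move=> FP totF.
have in_union z : add0 (\bigcup_(H in F) H)%classic z ->
    z = 0 \/ exists2 H, F H & H z.
  by case=> [->|[H FH Hz]]; [left|right; exists H].
split.
- move=> z /in_union[->|[H FH Hz]]; first by rewrite linear0.
  by have [gH _ _] := FP H FH; apply: gH; right.
- move=> c z w /in_union zF /in_union wF.
  have common : (z = 0 /\ w = 0) \/
      exists2 H, F H & add0 H z /\ add0 H w.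
    case: zF wF => [->|[H FH Hz]] [->|[H' FH' Hw]].
    + by left.
    + by right; exists H' => //; split; [left|right].
    + by right; exists H => //; split; [right|left].
    + right; have [HH'|H'H] := totF _ _ FH FH'.
        by exists H' => //; split; right; [apply: HH'|].
      by exists H => //; split; right; [|apply: H'H].
  case: common => [[-> ->]|[H FH [Hz Hw]]]; first by left; rewrite scaler0 addr0.
  have [_ cl _] := FP H FH.
  by case: (cl c z w Hz Hw) => [->|Hczw]; [left|right; exists H].
- move=> z /in_union[->|[H FH Hz]] //.
  by have [_ _ fH] := FP H FH; apply: fH; right.
Qed.

(** A maximal partial section is total: otherwise its domain D misses some
    e x, and it extends to D + R e x because R e x is simple, so meets D in 0. *)
Lemma split_surjection : exists h : {linear X -> A}, forall x, g (h x) = x.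
Proof.
have [G [PG maxG]] := Zorn_bigcup partial_section_chain.
have [gG clG fG] := PG; set H := add0 G in gG clG fG.
have H0 : H 0 by left.
have HD z w : H z -> H w -> H (z + w) by move=> Hz Hw; rewrite -[z]scale1r; apply: clG.
have HZ c z : H z -> H (c *: z) by move=> Hz; rewrite -[c *: z]addr0; apply: clG.
have HB z w : H z -> H w -> H (z - w) by move=> Hz Hw; rewrite -scaleN1r addrC; apply: clG.
suff /choice[h hH] x : exists a, H (x, a).
  have hlin : linear h.
    move=> c x y; apply/eqP; rewrite -subr_eq0; apply/eqP.
    have Hd := HB _ _ (hH (c *: x + y)) (HD _ _ (HZ c _ (hH x)) (hH y)).
    by apply: (fG _ Hd) => /=; rewrite subrr.
  by exists (mklin hlin) => x; rewrite mklinE; apply: (gG (x, h x)).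
apply: contrapT => nHx.
have [e es nHe] : exists2 e, e \in s & ~ exists a, H (e *: x, a).
  apply: contrapT => nex; apply: nHx.
  suff : exists a, H ((\sum_(e <- s) e) *: x, a) by rewrite sum_s scale1r.
  rewrite scaler_suml big_seq.
  apply: (big_ind (fun y => exists a, H (y, a))) => [|y y' [a Ha] [a' Ha']|e es].
  - by exists 0.
  - by exists (a + a'); apply: (HD (y, a) (y', a')).
  - by apply: contrapT => nHe; apply: nex; exists e.
have [a ga] := sg x.
pose H' : set (X * A) := fun z => exists2 w, H w & exists c, z = w + (c * e) *: (x, a).
have HH' z : H z -> H' z by move=> Hz; exists z => //; exists 0; rewrite mul0r scale0r addr0.
apply: (maxG H'); first split.
- by move=> z Gz; apply: HH'; right.
- move=> H'G; apply: nHe; exists (e *: a); right; apply: H'G.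
  by exists 0 => //; exists 1; rewrite mul1r add0r.
change (partial_section (add0 H')).
have -> : add0 H' = H'.
  by apply/seteqP; split=> [z [->|//]|z]; [apply: HH'|right].
split.
- move=> _ [w Hw [c ->]] /=; rewrite linearD linearZ /= ga; congr (_ + _).
  exact: gG.
- move=> d _ _ [w Hw [c ->]] [w' Hw' [c' ->]].
  exists (d *: w + w'); first exact: clG.
  by exists (d * c + c'); rewrite mulrDl scalerDl scalerDr scalerA mulrA addrACA.
- move=> _ [w Hw [c ->]] /= /eqP; rewrite addr_eq0 => /eqP w1.
  have [ce0|[d dce]] := minimal_s c es.
    by move: w1; rewrite ce0 !scale0r oppr0 addr0; apply: fG.
  case: nHe; exists (d *: - w.2); rewrite -[in e *: x]dce -scalerA -[_ *: x]opprK -w1.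
  by rewrite -[(_, _)]/(d *: - w); apply: HZ; rewrite -sub0r; apply: HB.
Qed.

End Splitting.

Lemma semisimple_projective (P : lmodType R) : projective P.
Proof.
move=> A X g f sg; have [h hE] := split_surjection sg.
by exists (h \o f) => x /=; rewrite hE.
Qed.

End Semisimple.

(** * Exponent vectors *)

Section Vectors.
Variables (n : nat) (a : 'I_n -> nat).

(** Integer entries make all translations total; an index that leaves the range
    of meaning then simply denotes a zero arrow or a zero monomial. *)
Definition vec := {ffun 'I_n -> int}.

HB.instance Definition _ := GRing.Zmodule.on vec.

Implicit Types i j m v w : vec.

Definition unit_vec (u : 'I_n) : vec := [ffun v : 'I_n => if v == u then 1 else 0].

Lemma unit_vecE (u v : 'I_n) : unit_vec u v = if v == u then 1 else 0.
Proof. by rewrite ffunE. Qed.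

Lemma vecD (v w : vec) u : (v + w) u = v u + w u.
Proof. by rewrite [LHS]ffunE. Qed.

Lemma vecN (v : vec) u : (- v) u = - v u.
Proof. by rewrite [LHS]ffunE. Qed.

Lemma vec0 u : (0 : vec) u = 0.
Proof. by rewrite [LHS]ffunE. Qed.

Lemma vecMn (v : vec) p u : (v *+ p) u = v u * p%:Z.
Proof.
elim: p => [|p IH]; first by rewrite mulr0n vec0 mulr0.
by rewrite mulrS vecD IH; lia.
Qed.

Definition vecE := (unit_vecE, vecMn, vecN, vecD, vec0).

Definition inbox (v : vec) := [forall u, (0 <= v u < (a u)%:Z)].

Lemma inboxP v : reflect (forall u, 0 <= v u < (a u)%:Z) (inbox v).
Proof. exact: forallP. Qed.

Definition vec_of_ord N (f : {ffun 'I_n -> 'I_N}) : vec := [ffun u => (f u : nat)%:Z].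

Lemma vec_of_ord_inj N : injective (@vec_of_ord N).
Proof.
move=> f g /ffunP fg; apply/ffunP=> u; apply: val_inj.
by have := fg u; rewrite !ffunE => -[].
Qed.

Definition box : seq vec :=
  [seq v <- [seq vec_of_ord f | f : {ffun 'I_n -> 'I_(\max_u a u).+1}] | inbox v].

Lemma box_uniq : uniq box.
Proof.
by rewrite filter_uniq // map_inj_uniq ?enum_uniq //; apply: vec_of_ord_inj.
Qed.

Lemma mem_box v : (v \in box) = inbox v.
Proof.
rewrite mem_filter; case: inboxP => //= v_box.
apply/mapP; exists [ffun u => inord `|v u|%N]; first by rewrite mem_enum.
apply/ffunP=> u; rewrite !ffunE inordK.
  by rewrite gez0_abs //; case/andP: (v_box u).
have {v_box} vu : (`|v u| <= a u)%N by have := v_box u; lia.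
by rewrite ltnS (leq_trans vu) // (leq_bigmax_cond (F := a)).
Qed.

(** The triple (i, m, j) stands for the morphism from M_i to M_j that sends the
    generator to X^m.  It is well defined if X_u^(i_u + 1) kills X^m in M_j, that
    is, if j_u <= m_u + i_u, for all u. *)
Definition mor := (vec * vec * vec)%type.

Definition valid (t : mor) : bool :=
  [forall u, [&& 0 <= t.1.2 u, t.1.2 u <= t.2 u, t.2 u < (a u)%:Z,
    0 <= t.1.1 u < (a u)%:Z & t.2 u <= t.1.2 u + t.1.1 u]].

Lemma validP i m j : reflect
  (forall u, [&& 0 <= m u, m u <= j u, j u < (a u)%:Z,
    0 <= i u < (a u)%:Z & j u <= m u + i u]) (valid (i, m, j)).
Proof. exact: forallP. Qed.

Definition mors : seq mor := [seq t <- [seq (im, j) | im <- [seq (i, m) | i <- box,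
  m <- box], j <- box] | valid t].

Lemma mors_uniq : uniq mors.
Proof.
rewrite filter_uniq // allpairs_uniq ?box_uniq //; last by move=> [? ?] [? ?].
by rewrite allpairs_uniq ?box_uniq // => -[? ?] [? ?].
Qed.

Lemma valid_box i m j : valid (i, m, j) -> [/\ inbox i, inbox m & inbox j].
Proof.
by move=> /validP v; split; apply/inboxP=> u; have := v u; lia.
Qed.

Lemma mem_mors t : (t \in mors) = valid t.
Proof.
rewrite mem_filter; case: t => [[i m] j]; case V: (valid _) => //=.
have [ib mb jb] := valid_box V.
apply/allpairsP; exists ((i, m), j); split=> //=; last by rewrite mem_box.
by apply/allpairsP; exists (i, m); rewrite /= !mem_box.
Qed.

Lemma valid_id i : valid (i, 0, i) = inbox i.
Proof.
apply/validP/inboxP => v u; have := v u; rewrite vecE; lia.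
Qed.

End Vectors.

(** * Algebras with a monomial basis *)

Section MonomialAlgebra.
Variables (n : nat) (a : 'I_n -> nat) (k : fieldType).
Local Notation vec := (vec n).
Local Notation mor := (mor n).
Local Notation valid := (valid a).
Local Notation mors := (mors a).
Local Notation box := (box a).
Local Notation inbox := (inbox a).
Implicit Types i j l m v : vec.
Implicit Types t : mor.

Variable chi : vec -> vec -> k.
Hypothesis chiDl : forall m m' r, chi (m + m') r = chi m r * chi m' r.
Hypothesis chiDr : forall m r r', chi m (r + r') = chi m r * chi m r'.
Hypothesis chi_neq0 : forall m r, chi m r != 0.
Hypothesis chi_unit : forall u, chi (unit_vec u) (unit_vec u) = 1.

(** The element [E t x] is x times the basis element of index t. *)
Variables (A : pzRingType) (E : mor -> k -> A) (coef : A -> mor -> k).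
Hypothesis ED : forall t x y, E t (x + y) = E t x + E t y.
Hypothesis E_out : forall t x, ~~ valid t -> E t x = 0.
Hypothesis E_mul : forall i m j m' l x y, valid (i, m, j) -> valid (j, m', l) ->
  E (j, m', l) y * E (i, m, j) x = E (i, m + m', l) (chi m m' * (x * y)).
Hypothesis E_mul0 : forall i m j j' m' l x y, j != j' ->
  E (j', m', l) y * E (i, m, j) x = 0.
Hypothesis E_expand : forall z, z = \sum_(t <- mors) E t (coef z t).
Hypothesis coefD : forall z z' t, coef (z + z') t = coef z t + coef z' t.
Hypothesis coefE : forall t x t', valid t -> coef (E t x) t' = if t' == t then x else 0.
Hypothesis E_one : 1 = \sum_(i <- box) E (i, 0, i) 1.

Lemma chi0l r : chi 0 r = 1.
Proof. by apply: (mulfI (chi_neq0 0 r)); rewrite -chiDl addr0 mulr1. Qed.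

Lemma chi0r r : chi r 0 = 1.
Proof. by apply: (mulfI (chi_neq0 r 0)); rewrite -chiDr addr0 mulr1. Qed.

Lemma E0 t : E t 0 = 0.
Proof. by apply: (addrI (E t 0)); rewrite -ED !addr0. Qed.

Lemma coef0 t : coef 0 t = 0.
Proof. by apply: (addrI (coef 0 t)); rewrite -coefD !addr0. Qed.

Lemma coefN z t : coef (- z) t = - coef z t.
Proof. by apply: (addrI (coef z t)); rewrite -coefD !subrr coef0. Qed.

Section Span.
Variable Q : pred mor.

Definition span_pred : {pred A} :=
  fun z => `[< forall t, ~~ Q t -> coef z t = 0 >].

Lemma span_predP z : reflect (forall t, ~~ Q t -> coef z t = 0) (z \in span_pred).
Proof. exact: asboolP. Qed.

Lemma span_expand z : z \in span_pred -> z = \sum_(t <- mors | Q t) E t (coef z t).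
Proof.
move=> /span_predP zQ; rewrite [LHS]E_expand [LHS](bigID Q) /= [X in _ + X]big1 ?addr0 //.
by move=> t nQt; rewrite zQ // E0.
Qed.

Lemma span_E t x : Q t -> E t x \in span_pred.
Proof.
move=> Qt; apply/span_predP=> t' nQt'; have [Vt|nVt] := boolP (valid t).
  by rewrite coefE //; case: eqP => // t't; rewrite t't Qt in nQt'.
by rewrite E_out // coef0.
Qed.

Lemma span_zmod : zmod_closed span_pred.
Proof.
split=> [|x y /span_predP xQ /span_predP yQ]; apply/span_predP=> t nQt.
  exact: coef0.
by rewrite coefD coefN xQ // yQ // subrr.
Qed.

HB.instance Definition _ := GRing.isZmodClosed.Build A span_pred span_zmod.

Lemma span_ind (P : A -> Prop) z :
    P 0 -> (forall x y, P x -> P y -> P (x + y)) ->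
    (forall t x, valid t -> Q t -> P (E t x)) ->
  z \in span_pred -> P z.
Proof.
move=> P0 PD PE /span_expand ->; rewrite big_seq_cond.
by apply: big_ind => // t /andP[]; rewrite mem_mors => Vt Qt; apply: PE.
Qed.

Hypothesis Q_mul : forall i m j m' l,
  Q (i, m, j) -> Q (j, m', l) -> Q (i, m + m', l).
Hypothesis Q_id : forall i, Q (i, 0, i).

(** It suffices that the index set is closed under composition. *)
Lemma span_subring : subring_closed span_pred.
Proof.
split; first 1 last.
- by have [] := span_zmod.
- move=> x y xQ yQ; apply: (span_ind (P := fun x => x * y \in span_pred)) xQ.
  + by rewrite mul0r rpred0.
  + by move=> z z' ? ?; rewrite mulrDl rpredD.
  move=> [[j' m'] l] {}x Vt Qt; apply: (span_ind (P := fun y => _ * y \in span_pred)) yQ.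
  + by rewrite mulr0 rpred0.
  + by move=> z z' ? ?; rewrite mulrDr rpredD.
  move=> [[i m] j] {}y Vt' Qt'; have [jj|nj] := eqVneq j j'; last by rewrite E_mul0 ?rpred0.
  by rewrite -{}jj in Vt Qt *; rewrite E_mul //; apply: span_E; apply: Q_mul Qt' Qt.
- rewrite E_one; apply: rpred_sum => i _; exact: span_E.
Qed.

End Span.

Definition extend (h : mor -> k -> A) (z : A) : A := \sum_(t <- mors) h t (coef z t).

Lemma extendD h : (forall t x y, h t (x + y) = h t x + h t y) ->
  forall z z', extend h (z + z') = extend h z + extend h z'.
Proof.
by move=> hD z z'; rewrite -big_split; apply: eq_bigr => t _; rewrite coefD hD.
Qed.

Lemma extendE h t x : (forall t x y, h t (x + y) = h t x + h t y) ->
  valid t -> extend h (E t x) = h t x.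
Proof.
move=> hD Vt; have h0 t' : h t' 0 = 0 by apply: (addrI (h t' 0)); rewrite -hD !addr0.
rewrite /extend (bigD1_seq t) ?mem_mors ?mors_uniq //= coefE // eqxx.
by rewrite big1 ?addr0 // => t' /negPf nt; rewrite coefE // nt.
Qed.

(** * The subring spanned by a closed family of basis elements *)

Record closed_sys := ClosedSys {
  cs_pred :> pred mor;
  cs_mul : forall i m j m' l,
    cs_pred (i, m, j) -> cs_pred (j, m', l) -> cs_pred (i, m + m', l);
  cs_id : forall i, cs_pred (i, 0, i) }.

Section SpanRing.
Variable S : closed_sys.

Definition span_ring_pred : {pred A} := span_pred S.

HB.instance Definition _ := GRing.isSubringClosed.Build A span_ring_pred
  (span_subring (@cs_mul S) (@cs_id S)).

Definition span_ring : Type := {z : A | z \in span_ring_pred}.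

HB.instance Definition _ := SubType.on span_ring.
HB.instance Definition _ := [Choice of span_ring by <:].
HB.instance Definition _ := GRing.SubChoice_isSubPzRing.Build A span_ring_pred
  span_ring (span_subring (@cs_mul S) (@cs_id S)).

Definition mk_span z (zS : z \in span_pred S) : span_ring := exist _ z zS.

Lemma span_ringP (z : span_ring) : val z \in span_pred S.
Proof. by case: z. Qed.

End SpanRing.

Definition span_incl (S S' : closed_sys) (SS' : forall t, S t -> S' t)
  (z : span_ring S) : span_ring S'.
Proof.
apply: (@mk_span S' (val z)); apply/span_predP => t nS't.
by have /span_predP := span_ringP z; apply; apply: contra nS't; apply: SS'.
Defined.

Lemma span_incl_zmod (S S' : closed_sys) (SS' : forall t, S t -> S' t) :
  zmod_morphism (span_incl SS').
Proof. by move=> x y; apply: val_inj. Qed.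

Lemma span_incl_monoid (S S' : closed_sys) (SS' : forall t, S t -> S' t) :
  monoid_morphism (span_incl SS').
Proof. by split=> [|x y]; apply: val_inj. Qed.

Definition span_inclusion (S S' : closed_sys) (SS' : forall t, S t -> S' t) :
    {rmorphism span_ring S -> span_ring S'} :=
  HB.pack (span_incl SS')
    (GRing.isZmodMorphism.Build _ _ _ (span_incl_zmod SS'))
    (GRing.isMonoidMorphism.Build _ _ _ (span_incl_monoid SS')).

(** * Adjoining one arrow direction *)

Section Step.
(** The algebra spanned by [Q'] is graded by [deg], its part of degree 0 is
    spanned by [Q], and the new generator is the sum over i of the arrows
    (i, w, i + tau), of degree 1.  The remaining hypotheses compare the triples
    that occur in the proofs: arrows that should agree vanish together. *)
Variables (Q Q' : closed_sys) (w tau : vec) (deg : mor -> int) (N : nat).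

Hypothesis QQ' : forall t, Q t -> Q' t.
Hypothesis chi_w : chi w w = 1.
Hypothesis Q'_gam : forall i p, Q' (i, w *+ p, i + tau *+ p).
Hypothesis deg_gam : forall i p, deg (i, w *+ p, i + tau *+ p) = p%:Z.
Hypothesis deg_bound : forall t, valid t -> Q' t -> 0 <= deg t < N%:Z.
Hypothesis deg_mul : forall i m j m' l, Q (i, m, j) ->
  deg (i, m + m', l) = deg (j, m', l).
Hypothesis valid_gam : forall i p,
  valid (i, w *+ p, i + tau *+ p) = inbox i && inbox (i + tau *+ p).
Hypothesis box_convex : forall i p r,
  inbox i -> inbox (i + tau *+ (p + r)) -> inbox (i + tau *+ p).
Hypothesis box_bound : forall i, inbox i -> ~~ inbox (i - tau *+ N).
Hypothesis Q_shift : forall i m j, Q (i, m, j) -> Q (i - tau, m, j - tau).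
Hypothesis valid_comm : forall i m j, valid (i, m, j) -> Q (i, m, j) ->
  valid (i - tau, m + w, j) ->
  [/\ valid (i - tau, w, i), valid (i - tau, m, j - tau) & valid (j - tau, w, j)].
Hypothesis valid_shift : forall i m j m' l, valid (i, m, j) -> Q (i, m, j) ->
  valid (j, m', l) -> Q (j, m', l) -> valid (i - tau, m + m', l - tau) ->
  [/\ valid (i, m + m', l), valid (i - tau, m, j - tau) & valid (j - tau, m', l - tau)].
Hypothesis valid_lower : forall i m j p, valid (i, m, j) -> Q' (i, m, j) ->
  deg (i, m, j) = p%:Z ->
  [/\ valid (i, m - w *+ p, j - tau *+ p), Q (i, m - w *+ p, j - tau *+ p) &
      valid (j - tau *+ p, w *+ p, j)].
Hypothesis valid_raise : forall i m j m' l p, valid (i, m, j) -> Q (i, m, j) ->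
  valid (j, m', l) -> Q' (j, m', l) -> deg (j, m', l) = p%:Z ->
  valid (i, m + m' - w *+ p, l - tau *+ p) -> valid (i, m + m', l).

Lemma E_mul_out i m j m' l x y :
    (valid (i, m + m', l) -> valid (i, m, j) /\ valid (j, m', l)) ->
  E (j, m', l) y * E (i, m, j) x = E (i, m + m', l) (chi m m' * (x * y)).
Proof.
move=> V; have [V1|V1] := boolP (valid (i, m, j)); last first.
  by rewrite [E (i, m, j) x]E_out // mulr0 E_out //; apply: contra V1 => /V[].
have [V2|V2] := boolP (valid (j, m', l)); last first.
  by rewrite [E (j, m', l) y]E_out // mul0r E_out //; apply: contra V2 => /V[].
exact: E_mul.
Qed.

Definition gam_pow p : A := \sum_(i <- box) E (i, w *+ p, i + tau *+ p) 1.

Lemma gam_pow_mull p i m j x : inbox j ->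
  gam_pow p * E (i, m, j) x = E (j, w *+ p, j + tau *+ p) 1 * E (i, m, j) x.
Proof.
move=> jb; rewrite mulr_suml (bigD1_seq j) ?mem_box ?box_uniq //= big1 ?addr0 //.
by move=> j' nj; rewrite E_mul0 // eq_sym.
Qed.

Lemma gam_pow_mulr p i m j x :
  E (i, m, j) x * gam_pow p = E (i, m, j) x * E (i - tau *+ p, w *+ p, i) 1.
Proof.
rewrite mulr_sumr; have [ib|nib] := boolP (inbox (i - tau *+ p)).
  rewrite (bigD1_seq (i - tau *+ p)) ?mem_box ?box_uniq //= subrK big1 ?addr0 //.
  move=> i' ni; rewrite E_mul0 //; apply: contraNneq ni => <-.
  by rewrite addrK.
rewrite [E (_ - _, _, _) 1]E_out ?mulr0; last by apply: contra nib => /valid_box[].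
rewrite big_seq big1 // => i'; rewrite mem_box => i'b.
rewrite E_mul0 //; apply: contraNneq nib => <-; by rewrite addrK.
Qed.

Lemma gam_pow0 : gam_pow 0 = 1.
Proof. by rewrite E_one; apply: eq_bigr => i _; rewrite !mulr0n addr0. Qed.

Lemma chi_wp p : chi (w *+ p) w = 1.
Proof. by elim: p => [|p IH]; rewrite ?chi0l // mulrS chiDl IH chi_w mulr1. Qed.

(** Intermediate steps stay in the box since the box is convex. *)
Lemma gam_powE p : gam_pow p = gam_pow 1 ^+ p.
Proof.
elim: p => [|p IH]; first by rewrite gam_pow0.
rewrite exprS -IH [gam_pow p]/gam_pow mulr_sumr [LHS]big_seq [RHS]big_seq.
apply: eq_bigr => i; rewrite mem_box => ib.
have [jb|njb] := boolP (inbox (i + tau *+ p)); last first.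
  rewrite [LHS]E_out; last first.
    by rewrite valid_gam ib /=; apply: contra njb; rewrite -addn1; apply: box_convex.
  by rewrite [E (i, _, _) 1]E_out ?mulr0 // valid_gam (negPf njb) andbF.
rewrite gam_pow_mull // E_mul_out.
  by rewrite mulrSr chi_wp !mulr1 !mulr1n mulrSr addrA.
rewrite !mulr1n -mulrSr -addrA -mulrSr valid_gam => /andP[_ ib'].
rewrite valid_gam ib jb; split=> //.
by have := valid_gam (i + tau *+ p) 1; rewrite !mulr1n jb -addrA -mulrSr => ->.
Qed.

(** Conjugation by the generator: translation by [tau] at both ends, with the
    scalar that compares the two orders of multiplication. *)
Definition theta_fun (t : mor) (x : k) : A :=
  E (t.1.1 - tau, t.1.2, t.2 - tau) (chi w t.1.2 / chi t.1.2 w * x).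

Lemma theta_funD t x y : theta_fun t (x + y) = theta_fun t x + theta_fun t y.
Proof. by rewrite /theta_fun mulrDr ED. Qed.

Definition theta := extend theta_fun.

Lemma theta_E i m j x : valid (i, m, j) ->
  theta (E (i, m, j) x) = E (i - tau, m, j - tau) (chi w m / chi m w * x).
Proof. by move=> V; rewrite /theta extendE //; apply: theta_funD. Qed.

Lemma thetaD x y : theta (x + y) = theta x + theta y.
Proof. by apply: extendD; apply: theta_funD. Qed.

Lemma theta0 : theta 0 = 0.
Proof. by apply: (addrI (theta 0)); rewrite -thetaD !addr0. Qed.

Lemma theta_span z : z \in span_pred Q -> theta z \in span_pred Q.
Proof.
apply: (span_ind (P := fun z => theta z \in span_pred Q)) => [|x y ? ?|[[i m] j] x V Qt].
- by rewrite theta0 rpred0.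
- by rewrite thetaD rpredD.
- by rewrite theta_E //; apply/span_E/Q_shift.
Qed.

Lemma thetaM x y : x \in span_pred Q -> y \in span_pred Q ->
  theta (x * y) = theta x * theta y.
Proof.
move=> xQ yQ.
apply: (span_ind (P := fun x => theta (x * y) = theta x * theta y)) xQ.
- by rewrite mul0r theta0 mul0r.
- by move=> z z' zE z'E; rewrite mulrDl !thetaD mulrDl zE z'E.
move=> [[j' m'] l] {}x Vt Qt; apply: (span_ind (P := fun y => theta (_ * y) = _ * theta y)) yQ.
- by rewrite mulr0 theta0 mulr0.
- by move=> z z' zE z'E; rewrite mulrDr !thetaD mulrDr zE z'E.
move=> [[i m] j] {}y Vt' Qt'; rewrite !theta_E //.
have [jj|nj] := eqVneq j j'; last first.
  by rewrite !E_mul0 ?theta0 //; apply: contra nj => /eqP/subIr->.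
rewrite -{}jj in Vt Qt *; rewrite E_mul // E_mul_out => [|V']; last first.
  by have [] := valid_shift Vt' Qt' Vt Qt V'.
have [V|nV] := boolP (valid (i, m + m', l)).
  rewrite theta_E // chiDl chiDr; congr (E _ _).
  by field; rewrite !chi_neq0.
rewrite E_out // theta0 E_out //; apply: contra nV.
by move=> V'; have [] := valid_shift Vt' Qt' Vt Qt V'.
Qed.

Lemma theta_comm z : z \in span_pred Q -> z * gam_pow 1 = gam_pow 1 * theta z.
Proof.
apply: (span_ind (P := fun z => z * gam_pow 1 = gam_pow 1 * theta z))
  => [|x y xE yE|[[i m] j] x V Qt].
- by rewrite theta0 mul0r mulr0.
- by rewrite mulrDl thetaD mulrDr xE yE.
rewrite theta_E // gam_pow_mulr !mulr1n.
have [V'|nV'] := boolP (valid (i - tau, m + w, j)).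
  have [V1 V2 V3] := valid_comm V Qt V'.
  rewrite gam_pow_mull; last by have [] := valid_box V2.
  rewrite !mulr1n subrK E_mul // E_mul // [w + m]addrC; congr (E _ _).
  rewrite !mulr1 mul1r [chi m w * _]mulrA; congr (_ * _).
  by rewrite mulrC divfK.
have [jb|njb] := boolP (inbox (j - tau)); last first.
  rewrite [E (i - tau, m, _) _]E_out ?mulr0; last by apply: contra njb => /valid_box[].
  by rewrite E_mul_out ?[w + m]addrC; [apply: E_out|move=> /(negP nV')].
rewrite gam_pow_mull // !mulr1n subrK.
by rewrite !E_mul_out ?[w + m]addrC ?[E (i - tau, m + w, j) _]E_out // => /(negP nV').
Qed.

(** The coordinate of index p is nonzero on arrows of degree p only, from which
    it strips the p-th power of the generator. *)
Definition phi_fun (p : nat) (t : mor) (x : k) : A :=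
  if deg t == p%:Z then
    E (t.1.1, t.1.2 - w *+ p, t.2 - tau *+ p) ((chi (t.1.2 - w *+ p) (w *+ p))^-1 * x)
  else 0.

Lemma phi_funD p t x y : phi_fun p t (x + y) = phi_fun p t x + phi_fun p t y.
Proof. by rewrite /phi_fun; case: ifP; rewrite ?addr0 // mulrDr ED. Qed.

Definition phi p := extend (phi_fun p).

Lemma phi_E p t x : valid t -> phi p (E t x) = phi_fun p t x.
Proof. by move=> V; rewrite /phi extendE //; apply: phi_funD. Qed.

Lemma phiD p x y : phi p (x + y) = phi p x + phi p y.
Proof. by apply: extendD; apply: phi_funD. Qed.

Lemma phi0 p : phi p 0 = 0.
Proof. by apply: (addrI (phi p 0)); rewrite -phiD !addr0. Qed.

Lemma phi_sum p (I : Type) (s : seq I) (P : pred I) (F : I -> A) :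
  phi p (\sum_(i <- s | P i) F i) = \sum_(i <- s | P i) phi p (F i).
Proof. by apply: (big_morph (phi p)) => [x y|]; [exact: phiD|exact: phi0]. Qed.

Lemma phi_span p z : z \in span_pred Q' -> phi p z \in span_pred Q.
Proof.
apply: (span_ind (P := fun z => phi p z \in span_pred Q)) => [|x y ? ?|[[i m] j] x V Q't].
- by rewrite phi0 rpred0.
- by rewrite phiD rpredD.
rewrite phi_E // /phi_fun; case: eqP => [dp|_]; last exact: rpred0.
by apply: span_E; have [] := valid_lower V Q't dp.
Qed.

Lemma phiM p c b : c \in span_pred Q' -> b \in span_pred Q ->
  phi p (c * b) = phi p c * b.
Proof.
move=> cQ bQ; apply: (span_ind (P := fun c => phi p (c * b) = phi p c * b)) cQ.
- by rewrite mul0r phi0 mul0r.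
- by move=> z z' zE z'E; rewrite mulrDl !phiD mulrDl zE z'E.
move=> [[j' m'] l] x Vt Qt; apply: (span_ind (P := fun b => phi p (_ * b) = phi p _ * b)) bQ.
- by rewrite mulr0 phi0 mulr0.
- by move=> z z' zE z'E; rewrite mulrDr !phiD mulrDr zE z'E.
move=> [[i m] j] y Vt' Qt'; rewrite phi_E // /phi_fun /=.
have [jj|nj] := eqVneq j j'; last first.
  by rewrite E_mul0 // phi0; case: ifP; rewrite ?mul0r // E_mul0.
rewrite -{}jj in Vt Qt *; rewrite E_mul //.
case: eqP => [dp|ndp]; last first.
  rewrite mul0r; have [V|nV] := boolP (valid (i, m + m', l)).
    by rewrite phi_E // /phi_fun (deg_mul _ _ Qt'); case: eqP.
  by rewrite E_out // phi0.
have [V1 Q1 V2] := valid_lower Vt Qt dp.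
rewrite E_mul // addrA; have [V|nV] := boolP (valid (i, m + m', l)); last first.
  rewrite E_out // phi0 E_out //; apply: contra nV.
  exact: valid_raise Vt' Qt' Vt Qt dp.
rewrite phi_E // /phi_fun (deg_mul _ _ Qt') dp eqxx /=; congr (E _ _).
rewrite -[m + m' - _]addrA.
have [r rE] : exists r, m' = r + w *+ p by exists (m' - w *+ p); rewrite subrK.
rewrite rE addrK chiDl [chi m (r + _)]chiDr.
by field; rewrite !chi_neq0.
Qed.

Lemma phi_expand c : c \in span_pred Q' ->
  \sum_(p < N) gam_pow 1 ^+ p * phi p c = c.
Proof.
apply: (span_ind (P := fun c => \sum_(p < N) gam_pow 1 ^+ p * phi p c = c))
  => [|x y xE yE|[[i m] j] x V Q't].
- by rewrite big1 // => p _; rewrite phi0 mulr0.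
- by under eq_bigr => p _ do rewrite phiD mulrDr; rewrite big_split /= xE yE.
have /andP[d0 dN] := deg_bound V Q't.
have [p dp] : exists p, deg (i, m, j) = p%:Z.
  by exists `|deg (i, m, j)|%N; rewrite gez0_abs.
have pN : (p < N)%N by rewrite dp in dN.
have [V1 Q1 V2] := valid_lower V Q't dp.
rewrite (bigD1 (Ordinal pN)) //= big1 ?addr0 => [|r nr]; last first.
  rewrite phi_E // /phi_fun dp; case: eqP => [[pr]|_]; last by rewrite mulr0.
  by case/eqP: nr; apply: val_inj.
rewrite phi_E // /phi_fun dp eqxx -gam_powE gam_pow_mull /=; last by have [] := valid_box V1.
rewrite subrK E_mul // subrK; congr (E _ _).
by rewrite mulr1 mulrA mulfV ?mul1r.
Qed.

Lemma sum_box_shift (F : vec -> A) v :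
    (forall i, ~~ (inbox i && inbox (i + v)) -> F i = 0) ->
  \sum_(i <- box) F i = \sum_(i <- box) F (i - v).
Proof.
move=> F0; rewrite [LHS](bigID (fun i => inbox (i + v))) /= [X in _ + X]big1 ?addr0; last first.
  by move=> i nb; rewrite F0 // (negPf nb) andbF.
rewrite [RHS](bigID (fun i => inbox (i - v))) /= [X in _ = _ + X]big1 ?addr0; last first.
  by move=> i nb; rewrite F0 // (negPf nb).
rewrite -big_filter -[RHS]big_filter -(big_map (fun i => i - v) predT F).
apply: perm_big; apply: uniq_perm.
- by rewrite filter_uniq ?box_uniq.
- by rewrite (map_inj_uniq (@addIr _ (- v))) filter_uniq ?box_uniq.
move=> i; rewrite mem_filter mem_box; apply/idP/mapP => [/andP[ivb ib]|[j]].
  by exists (i + v); rewrite ?addrK // mem_filter mem_box addrK ib.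
by rewrite mem_filter mem_box => /andP[jvb jb] ->; rewrite subrK jb.
Qed.

Lemma iter_theta1 p : iter p theta 1 = \sum_(i <- box) E (i - tau *+ p, 0, i - tau *+ p) 1.
Proof.
elim: p => [|p IH]; first by rewrite E_one; apply: eq_bigr => i _; rewrite mulr0n subr0.
rewrite iterS IH (big_morph theta thetaD theta0) [LHS]big_seq [RHS]big_seq.
apply: eq_bigr => i; rewrite mem_box => ib.
have [V|nV] := boolP (valid (i - tau *+ p, 0, i - tau *+ p)).
  rewrite theta_E // chi0l chi0r divr1 mulr1 mulrSr.
  by rewrite opprD addrA.
rewrite E_out // theta0 E_out // valid_id; apply: contra nV; rewrite valid_id => ib'.
have iE : i - tau *+ p = i - tau *+ p.+1 + tau *+ 1 by rewrite mulr1n mulrSr opprD addrA subrK.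
by rewrite iE; apply: (@box_convex _ _ p ib'); rewrite add1n subrK.
Qed.

(** Both sides are the sum of the identities at the vectors i for which
    i + p tau is in the box, once the sum on one side is translated. *)
Lemma phi_gam p r : phi r (gam_pow 1 ^+ p) = if p == r then iter p theta 1 else 0.
Proof.
rewrite -gam_powE phi_sum; case: eqP => [<-|pr]; last first.
  rewrite big1 // => i _; have [V|nV] := boolP (valid (i, w *+ p, i + tau *+ p)).
    by rewrite phi_E // /phi_fun deg_gam; case: eqP => // -[].
  by rewrite E_out // phi0.
rewrite iter_theta1 (sum_box_shift (v := tau *+ p)).
  rewrite [LHS]big_seq [RHS]big_seq; apply: eq_bigr => i; rewrite mem_box => ib.
  rewrite subrK; have [V|nV] := boolP (valid (i - tau *+ p, w *+ p, i)).
    rewrite phi_E // /phi_fun; have := deg_gam (i - tau *+ p) p.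
    by rewrite subrK => ->; rewrite eqxx /= subrr chi0l invr1 mulr1.
  rewrite E_out // phi0 E_out // valid_id; apply: contra nV => ib'.
  by have := valid_gam (i - tau *+ p) p; rewrite subrK ib ib' => ->.
by move=> i nb; rewrite E_out ?phi0 // valid_gam.
Qed.

Lemma iter_theta_out : iter N theta 1 = 0.
Proof.
rewrite iter_theta1 big_seq big1 // => i; rewrite mem_box => ib.
by rewrite E_out // valid_id box_bound.
Qed.

Lemma gam_span : gam_pow 1 \in span_pred Q'.
Proof. by rewrite rpred_sum // => i _; apply: span_E. Qed.

Lemma step_pd_le d : (forall Y : lmodType (span_ring Q), pd_le d Y) ->
  forall X : lmodType (span_ring Q'), pd_le d.+1 X.
Proof.
pose iota := span_inclusion QQ'.
pose gam : span_ring Q' := mk_span gam_span.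
pose th (b : span_ring Q) : span_ring Q := mk_span (theta_span (span_ringP b)).
pose ph (p : 'I_N) (c : span_ring Q') : span_ring Q := mk_span (phi_span p (span_ringP c)).
have gamX p : val (gam ^+ p) = gam_pow 1 ^+ p by rewrite rmorphXn.
have thX p : val (iter p th 1) = iter p theta 1.
  by elim: p => [|p IH] //=; rewrite IH.
apply: (@skew_extension_pd_le _ _ iota gam th N ph).
- by move=> p c e; apply: val_inj; apply: phiD.
- move=> p c b; apply: val_inj; apply: phiM; exact: span_ringP.
- move=> c; apply: val_inj; rewrite rmorph_sum -[RHS](phi_expand (span_ringP c)).
  by apply: eq_bigr => p _; rewrite -gamX.
- move=> q p; apply: val_inj; rewrite /= gamX phi_gam.
  by case: eqP => // _; rewrite thX.
- by move=> b c; apply: val_inj; apply: thetaD.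
- by move=> b c; apply: val_inj; apply: thetaM; apply: span_ringP.
- by move=> b; apply: val_inj; apply: theta_comm; apply: span_ringP.
- by apply: val_inj; rewrite thX iter_theta_out.
Qed.

End Step.

(** * The tower *)

(** The direction beta_u is present at level t if u < t, and alpha_u if
    n + u < t.  An arrow (i, m, j) first descends from i to j - m and then climbs
    to j, so the two conditions exclude the absent directions. *)
Definition tower_pred (t : nat) : pred mor := fun x =>
  [forall u : 'I_n, ((t <= u)%N ==> (x.1.1 u == x.2 u - x.1.2 u)) &&
                    ((t <= n + u)%N ==> (x.1.2 u == 0))].

Lemma tower_predP (t : nat) i m j : reflect
  (forall u : 'I_n, ((t <= u)%N ==> (i u == j u - m u)) &&
                    ((t <= n + u)%N ==> (m u == 0))) (tower_pred t (i, m, j)).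
Proof. exact: forallP. Qed.

Lemma tower_mul (t : nat) i m j m' l :
  tower_pred t (i, m, j) -> tower_pred t (j, m', l) -> tower_pred t (i, m + m', l).
Proof.
move=> /tower_predP V /tower_predP V'; apply/tower_predP => v.
by have := V v; have := V' v; rewrite vecE; lia.
Qed.

Lemma tower_id (t : nat) i : tower_pred t (i, 0, i).
Proof. by apply/tower_predP => v; rewrite vecE; lia. Qed.

Definition tower (t : nat) : closed_sys := ClosedSys (@tower_mul t) (@tower_id t).

Lemma towerS (t : nat) (x : mor) : tower t x -> tower t.+1 x.
Proof.
move: x => [[i m] j] /tower_predP V; apply/tower_predP => v.
by have := V v; lia.
Qed.

Ltac at_point v := repeat match goal with
  | H : is_true (valid _) |- _ => move: H => /validP /(_ v)
  | H : is_true (inbox _) |- _ => move: H => /inboxP /(_ v)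
  | H : is_true (tower_pred _ _) |- _ => move: H => /tower_predP /(_ v)
  | H : is_true (cs_pred _ _) |- _ => move: H => /tower_predP /(_ v)
  end.

(* Every condition on triples below is linear arithmetic at each coordinate, and
   the coordinate u is the only one that a step treats differently. *)
Ltac points u := let v := fresh "v" in
  first [apply/validP => v | apply/inboxP => v | apply/tower_predP => v];
  at_point v; have := ltn_ord u; have := ltn_ord v; rewrite ?vecE;
  have [->|] := eqVneq v u; [rewrite ?vecE ?eqxx | rewrite -val_eqE];
  rewrite /=; lia.

(** The projections commute with everything present so far, without scalars. *)
Lemma beta_pd_le (u : 'I_n) d :
    (forall Y : lmodType (span_ring (tower u)), pd_le d Y) ->
  forall X : lmodType (span_ring (tower u.+1)), pd_le d.+1 X.
Proof.
apply: (@step_pd_le _ _ 0 (- unit_vec u) (fun x => x.1.1 u - x.2 u + x.1.2 u) (a u)).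
- exact: towerS.
- exact: chi0l.
- by move=> i p; points u.
- by move=> i p; rewrite /= !vecE eqxx; lia.
- by move=> [[i m] j] V Q'; rewrite /=; at_point u; lia.
- by move=> i m j m' l Q; rewrite /= !vecE; at_point u; rewrite leqnn; lia.
- move=> i p; apply/idP/andP => [V|[ib jb]].
    by have [] := valid_box V.
  by points u.
- move=> i p r ib jb; points u.
- move=> i ib; apply/negP => ib'; at_point u; rewrite !vecE eqxx; lia.
- by move=> i m j Q; points u.
- by move=> i m j V Q V'; split; points u.
- by move=> i m j m' l V Q V' Q' V''; split; points u.
- move=> i m j p V Q; rewrite /= => dp.
  by split; points u.
- move=> i m j m' l p V Q V' Q'; rewrite /= => dp V''.
  by points u.
Qed.

Lemma alpha_pd_le (u : 'I_n) d :
    (forall Y : lmodType (span_ring (tower (n + u))), pd_le d Y) ->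
  forall X : lmodType (span_ring (tower (n + u).+1)), pd_le d.+1 X.
Proof.
apply: (@step_pd_le _ _ (unit_vec u) (unit_vec u) (fun x => x.1.2 u) (a u)).
- exact: towerS.
- exact: chi_unit.
- by move=> i p; points u.
- by move=> i p; rewrite /= !vecE eqxx; lia.
- by move=> [[i m] j] V Q'; rewrite /=; at_point u; lia.
- by move=> i m j m' l Q; rewrite /= !vecE; at_point u; rewrite leqnn; lia.
- move=> i p; apply/idP/andP => [V|[ib jb]].
    by have [] := valid_box V.
  by points u.
- by move=> i p r ib jb; points u.
- move=> i ib; apply/negP => ib'; at_point u; rewrite !vecE eqxx; lia.
- by move=> i m j Q; points u.
- move=> i m j V Q V'; split; points u.
- move=> i m j m' l V Q V' Q' V''; split; points u.
- move=> i m j p V Q; rewrite /= => dp.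
  by split; points u.
- move=> i m j m' l p V Q V' Q'; rewrite /= => dp V''.
  by points u.
Qed.

Lemma tower0_diag i m j : tower 0 (i, m, j) -> m = 0 /\ i = j.
Proof.
move=> /tower_predP Q; have m0 (v : 'I_n) : m v = 0 :> int by have := Q v; lia.
split; apply/ffunP => v; first by rewrite vecE m0.
have : i v = j v :> int by have := Q v; rewrite m0; lia.
by [].
Qed.

(** The bottom of the tower is spanned by orthogonal idempotents. *)
Lemma tower0_pd_le (Y : lmodType (span_ring (tower 0))) : pd_le 0 Y.
Proof.
pose e i : span_ring (tower 0) := mk_span (span_E (Q := tower 0) 1 (tower_id 0 i)).
apply: (@semisimple_projective _ [seq e i | i <- box]).
  by rewrite big_map; apply: val_inj; rewrite rmorph_sum; apply: (esym E_one).
move=> f z /mapP[i]; rewrite mem_box => ib ->{f}.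
have Vi : valid (i, 0, i) by rewrite valid_id.
have [x zeE] : exists x, val z * E (i, 0, i) 1 = E (i, 0, i) x.
  apply: (span_ind (P := fun z => exists x, z * E (i, 0, i) 1 = E (i, 0, i) x)) (span_ringP z).
  - by exists 0; rewrite mul0r E0.
  - by move=> z1 z2 [x1 E1] [x2 E2]; exists (x1 + x2); rewrite mulrDl ED E1 E2.
  - move=> [[i' m] j] x V /tower0_diag[m0 ij]; rewrite {}m0 {}ij in V *.
    have [->|ni] := eqVneq j i; last by exists 0; rewrite E0 E_mul0 // eq_sym.
    by exists x; rewrite E_mul // addr0 chi0l !mul1r.
have [x0|x0] := eqVneq x 0; [left|right].
  by apply: val_inj; rewrite -[LHS]/(val z * E (i, 0, i) 1) zeE x0 E0.
exists (mk_span (span_E (Q := tower 0) x^-1 (tower_id 0 i))); apply: val_inj.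
rewrite -[LHS]/(E (i, 0, i) x^-1 * (val z * E (i, 0, i) 1)).
by rewrite zeE E_mul // addr0 chi0l mul1r mulfV.
Qed.

Lemma tower_pd_le (t : nat) : (t <= n + n)%N ->
  forall Y : lmodType (span_ring (tower t)), pd_le t Y.
Proof.
elim: t => [|t IH] tn; first exact: tower0_pd_le.
have {}IH := IH (ltnW tn).
have [tn'|nt] := ltnP t n; first exact: (beta_pd_le (u := Ordinal tn') IH).
have un : (t - n < n)%N by rewrite ltn_subLR.
have := @alpha_pd_le (Ordinal un) t; rewrite /= subnKC //; exact.
Qed.

(** At the top of the tower no direction is absent. *)
Lemma monomial_algebra_pd_le (X : lmodType A) : pd_le (n + n) X.
Proof.
move: X; apply: (@pd_le_ring_iso _ _ (val : {rmorphism span_ring (tower (n + n)) -> A}));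
  last exact: tower_pd_le.
have top z : z \in span_pred (tower (n + n)).
  apply/span_predP => -[[i m] j] /negP[]; apply/tower_predP => v.
  by have := ltn_ord v; lia.
by exists (fun z => mk_span (top z)) => z //; apply: val_inj.
Qed.


End MonomialAlgebra.

(** * The quantum complete intersection by generators and relations *)

Section FreeAlgebra.
Variables (k : fieldType) (n : nat).
Local Notation F := (free_alg k n).

Lemma malg_ind (P : F -> Prop) :
    P 0 -> (forall x y, P x -> P y -> P (x + y)) ->
    (forall c (w : {fmonom 'I_n}), P << c *g w >>) ->
  forall z, P z.
Proof. by move=> P0 PD PU z; rewrite [z]monalgE; apply: big_ind. Qed.

Lemma malgUM c c' (w w' : {fmonom 'I_n}) :
  << c *g w >> * << c' *g w' >> = << (c * c') *g mmul w w' >> :> F.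
Proof. by rewrite malgM_def fgmulUU. Qed.

Lemma malg_word c (s : seq 'I_n) :
  << c *g FMonom s >> = c%:MP * \prod_(u <- s) free_var k u :> F.
Proof.
elim/last_ind: s => [|s u IH].
  by rewrite big_nil mulr1 -fmoneE.
rewrite big_rcons mulrA -IH /free_var malgUM mulr1; congr << _ *g _ >>.
by apply/eqP; rewrite fmP /= fmM fmU cats1.
Qed.

Section Evaluation.
Variables (V : lmodType k) (X : 'I_n -> {linear V -> V}).

Definition word_act (w : seq 'I_n) (v : V) : V := foldr (fun u => X u) v w.

Lemma word_act_linear w : linear (word_act w).
Proof. by elim: w => [|u w IH] c x y //=; rewrite IH linearP. Qed.

Definition free_act (z : F) (v : V) : V := \sum_(w <- msupp z) z@_w *: word_act w v.

Lemma free_actEw (d : {fset {fmonom 'I_n}}) z v : (msupp z `<=` d)%fset ->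
  free_act z v = \sum_(w <- d) z@_w *: word_act w v.
Proof.
move=> le; rewrite [LHS](big_fset_incl _ le) => //= x xd /mcoeff_outdom ->.
by rewrite scale0r.
Qed.

Lemma free_actU c w v : free_act << c *g w >> v = c *: word_act w v.
Proof. by rewrite (free_actEw _ msuppU_le) big_seq_fset1 mcoeffUU. Qed.

Lemma free_actDl y z v : free_act (y + z) v = free_act y v + free_act z v.
Proof.
pose d := (msupp y `|` msupp z)%fset.
rewrite !(@free_actEw d) ?fsubsetUl ?fsubsetUr ?msuppD_le // -big_split.
by apply: eq_bigr => w _; rewrite mcoeffD scalerDl.
Qed.

Lemma free_act_linear z : linear (free_act z).
Proof.
move=> c x y; rewrite scaler_sumr -big_split; apply: eq_bigr => w _ /=.
by rewrite word_act_linear scalerDr !scalerA mulrC.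
Qed.

Lemma word_act_cat w w' v : word_act (w ++ w') v = word_act w (word_act w' v).
Proof. exact: foldr_cat. Qed.

Lemma word_actZ w c v : word_act w (c *: v) = c *: word_act w v.
Proof. exact: (linearZ_LR (mklin (word_act_linear w))). Qed.

Lemma free_actr0 z : free_act z 0 = 0.
Proof. exact: (linear0 (mklin (free_act_linear z))). Qed.

Lemma free_actDr z v w : free_act z (v + w) = free_act z v + free_act z w.
Proof. exact: (linearD (mklin (free_act_linear z))). Qed.

Lemma free_act0 v : free_act 0 v = 0.
Proof. by rewrite /free_act msupp0 big_seq_fset0. Qed.

Lemma free_actM y z v : free_act (y * z) v = free_act y (free_act z v).
Proof.
move: y; apply: malg_ind => [|y y' IH IH'|c w].
- by rewrite mul0r !free_act0.
- rewrite mulrDl; apply: (etrans (free_actDl _ _ _)).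
  exact: (etrans (f_equal2 +%R IH IH') (esym (free_actDl _ _ _))).
move: z; apply: malg_ind => [|z z' IH IH'|c' w'].
- by rewrite mulr0 free_act0 free_actr0.
- rewrite mulrDr; apply: (etrans (free_actDl _ _ _)).
  apply: (etrans (f_equal2 +%R IH IH')); rewrite -free_actDr.
  by congr (free_act _ _); apply: esym; apply: free_actDl.
rewrite malgUM; apply: (etrans (free_actU _ _ _)).
rewrite fmM word_act_cat -scalerA -word_actZ; apply: esym.
apply: (etrans (free_actU _ _ _)); congr (_ *: word_act _ _).
exact: free_actU.
Qed.

Lemma free_actB y z v : free_act (y - z) v = free_act y v - free_act z v.
Proof.
apply: (addIr (free_act z v)); rewrite subrK.
by apply: (etrans (esym (free_actDl _ _ _))); congr (free_act _ v); apply: subrK.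
Qed.

Lemma free_actZ c z v : free_act (c *: z) v = c *: free_act z v.
Proof.
rewrite -mul_malgC; apply: (etrans (free_actM _ _ _)).
by apply: (etrans (free_actU _ _ _)); rewrite fm1.
Qed.

Lemma free_actC c v : free_act c%:MP v = c *: v.
Proof. by rewrite free_actU fm1. Qed.

Lemma free_act_var u v : free_act (free_var k u) v = X u v.
Proof. by rewrite free_actU fmU scale1r. Qed.

End Evaluation.
End FreeAlgebra.

Section Qci.
Variables (k : fieldType) (n : nat) (a : 'I_n -> nat) (q : 'I_n -> 'I_n -> k).
Local Notation L := (qci a q).
Local Notation pi := (@quot_proj _ (qci_relator a q)).

Definition qci_gen u : L := pi (free_var k u).
Definition qci_cst (c : k) : L := pi c%:MP.

Lemma piM x y : pi (x * y) = pi x * pi y :> L.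
Proof. exact: quot_projM. Qed.

Lemma piD x y : pi (x + y) = pi x + pi y :> L.
Proof. exact: quot_projD. Qed.

Lemma piB x y : pi (x - y) = pi x - pi y :> L.
Proof.
apply: (addIr (pi y)); rewrite subrK.
by apply: (etrans (esym (piD _ _))); congr pi; apply: subrK.
Qed.

Lemma qci_cstD c d : qci_cst (c + d) = qci_cst c + qci_cst d.
Proof. by rewrite /qci_cst raddfD quot_projD. Qed.

Lemma qci_cstB c d : qci_cst (c - d) = qci_cst c - qci_cst d.
Proof. by rewrite /qci_cst raddfB piB. Qed.

Lemma qci_cst1 : qci_cst 1 = 1.
Proof. by rewrite /qci_cst mpolyC1E. Qed.

Lemma qci_cstM c d : qci_cst (c * d) = qci_cst c * qci_cst d.
Proof. by rewrite /qci_cst mpolyCM piM. Qed.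

Lemma qci_cst0 : qci_cst 0 = 0.
Proof. by apply: (addrI (qci_cst 0)); rewrite -qci_cstD !addr0. Qed.

Lemma qci_cst_comm c y : qci_cst c * y = y * qci_cst c.
Proof.
have E z : c%:MP * z = z * c%:MP :> free_alg k n.
  rewrite mul_malgC; move: z; apply: malg_ind => [|y1 y2 E1 E2|d w].
  - by rewrite scaler0 mul0r.
  - by rewrite scalerDr mulrDl E1 E2.
  by rewrite -mul_malgC !malgUM mulrC mulm1 mul1m.
rewrite -[y]quot_projK.
exact: (etrans (esym (piM _ _)) (etrans (congr1 pi (E _)) (piM _ _))).
Qed.

Lemma qci_ind (P : L -> Prop) :
    P 0 -> (forall x y, P x -> P y -> P (x + y)) ->
    (forall c w, P (qci_cst c * \prod_(u <- w) qci_gen u)) ->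
  forall y, P y.
Proof.
move=> P0 PD Pw y; rewrite -[y]quot_projK; move: (repr y).
apply: (malg_ind (P := fun z => P (pi z))).
- by have -> : pi 0 = 0 by rewrite -malgC0E -[LHS]/(qci_cst 0) qci_cst0.
- by move=> x z Px Pz; rewrite quot_projD; apply: PD.
move=> c [s]; rewrite malg_word piM.
have -> : pi (\prod_(u <- s) free_var k u) = \prod_(u <- s) qci_gen u by apply: (big_morph pi piM).
exact: Pw.
Qed.

Lemma relator0 z : qci_relator a q z -> pi z = 0.
Proof.
move=> Rz; have -> : (0 : L) = pi 0 by rewrite -malgC0E -[RHS]/(qci_cst 0) qci_cst0.
by apply/quot_proj_eq; rewrite subr0 => I _ SI; apply: SI.
Qed.

Lemma qci_gen_pow u : qci_gen u ^+ a u = 0.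
Proof.
rewrite -(relator0 (qci_power a q u)) /qci_gen.
by elim: (a u) => [|p IH]; rewrite ?expr0 // !exprS piM IH.
Qed.

Lemma qci_gen_comm (i j : 'I_n) : (i < j)%N ->
  qci_gen i * qci_gen j = qci_cst (q i j) * (qci_gen j * qci_gen i).
Proof.
move=> ij; have := relator0 (qci_commutation a q ij).
rewrite piB -mul_malgC => /eqP; rewrite subr_eq0 => /eqP E.
apply: (etrans (esym (piM _ _))); apply: (etrans E); apply: (etrans (piM _ _)).
exact: (congr1 (fun z => qci_cst (q i j) * z) (piM _ _)).
Qed.

Section Representation.
Variables (V : lmodType k) (X : 'I_n -> {linear V -> V}).
Hypothesis X_pow : forall u v, iter (a u) (X u) v = 0.
Hypothesis X_comm : forall (i j : 'I_n) v, (i < j)%N -> X i (X j v) = q i j *: X j (X i v).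

(** The elements that act by zero form a two-sided ideal, which contains the
    relators. *)
Lemma free_act_ideal z : ideal_gen (qci_relator a q) z -> forall v, free_act X z v = 0.
Proof.
move=> Iz; pose I := [set z | forall v, free_act X z v = 0]%classic.
have I0 y v : I y -> free_act X y v = 0 by apply.
apply: (Iz I); first split.
- by move=> v; apply: free_act0.
- by move=> x y Ix Iy v; rewrite free_actB Ix Iy subrr.
- by move=> y x Ix v; rewrite free_actM Ix free_actr0.
- by move=> y x Ix v; rewrite free_actM Ix.
move=> _ [u|i j ij] v.
  rewrite -[RHS](X_pow u v); elim: (a u) v => [|p IH] v.
    by rewrite expr0 -mpolyC1E free_actC scale1r.
  by rewrite exprS free_actM IH free_act_var.
rewrite free_actB free_actZ; apply/eqP; rewrite subr_eq0; apply/eqP.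
have E u u' : free_act X (free_var k u * free_var k u') v = X u (X u' v).
  by apply: (etrans (free_actM _ _ _ _)); rewrite !free_act_var.
exact: (etrans (E i j) (etrans (X_comm v ij)
  (congr1 (fun z => q i j *: z) (esym (E j i))))).
Qed.

(** The operators and the proofs of the relations occur in the type so that the
    module structure can be inferred from it. *)
Definition qrep (_ : forall u v, iter (a u) (X u) v = 0)
  (_ : forall (i j : 'I_n) v, (i < j)%N -> X i (X j v) = q i j *: X j (X i v)) : Type := V.

Local Notation rep := (qrep X_pow X_comm).

HB.instance Definition _ := GRing.Zmodule.on rep.

Definition qact (y : L) (v : rep) : rep := free_act X (repr y) v.

Lemma qact_proj z v : qact (pi z) v = free_act X z v.
Proof.
have /quot_proj_eq Iz : pi (repr (pi z)) = pi z by rewrite quot_projK.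
by have := free_act_ideal Iz v; rewrite free_actB => /eqP; rewrite subr_eq0 => /eqP.
Qed.

Lemma qactA x y v : qact x (qact y v) = qact (x * y) v.
Proof.
by rewrite -[x]quot_projK -[y]quot_projK -piM !qact_proj free_actM.
Qed.

Lemma qact1 : left_id 1 qact.
Proof. by move=> v; rewrite -[1]qci_cst1 qact_proj free_actC scale1r. Qed.

Lemma qactDr : right_distributive qact +%R.
Proof. by move=> y v w; apply: free_actDr. Qed.

Lemma qactDl v : {morph qact^~ v : x y / x + y}.
Proof.
move=> x y; rewrite -[x]quot_projK -[y]quot_projK -quot_projD !qact_proj.
exact: free_actDl.
Qed.

HB.instance Definition _ := GRing.Zmodule_isLmodule.Build L rep
  qactA qact1 qactDr qactDl.

Lemma qci_gen_act u (v : rep) : qci_gen u *: v = X u v.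
Proof. by rewrite -[LHS]/(qact _ _) qact_proj free_act_var. Qed.

Lemma qci_cst_act c (v : rep) : qci_cst c *: v = c *: (v : V).
Proof. by rewrite -[LHS]/(qact _ _) qact_proj free_actC. Qed.

End Representation.

Lemma qci_linear (M N : lmodType L) (f : M -> N) :
    (forall x y, f (x + y) = f x + f y) ->
    (forall c x, f (qci_cst c *: x) = qci_cst c *: f x) ->
    (forall u x, f (qci_gen u *: x) = qci_gen u *: f x) ->
  linear f.
Proof.
move=> fD fc fX y x z; rewrite fD; congr (_ + _).
have f0 : f 0 = 0 by apply: (addrI (f 0)); rewrite -fD !addr0.
move: y x; apply: qci_ind => [x|y y' IH IH' x|c w x].
- by rewrite !scale0r f0.
- by rewrite !scalerDl fD IH IH'.
rewrite -!scalerA fc; congr (_ *: _); elim: w => [|u w IH].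
  by rewrite big_nil !scale1r.
by rewrite big_cons -!scalerA fX IH.
Qed.

End Qci.

(** * The bicharacter *)

Section Bicharacter.
Variables (k : fieldType) (n : nat) (q : 'I_n -> 'I_n -> k).
Hypothesis q_neq0 : forall i j : 'I_n, (i < j)%N -> q i j != 0.
Local Notation vec := (vec n).

(** No relation constrains [q i j] for j <= i, where it may even vanish. *)
Definition qq (i j : 'I_n) : k := if (i < j)%N then q i j else 1.

Lemma qq_neq0 i j : qq i j != 0.
Proof. by rewrite /qq; case: ifP => [/q_neq0|]; rewrite ?oner_neq0. Qed.

(** For ordered monomials, X^m X^r = chi m r X^(m + r). *)
Definition chi (m r : vec) : k := \prod_i \prod_j (qq i j) ^ (- (m j * r i)).

Lemma chiDl m m' r : chi (m + m') r = chi m r * chi m' r.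
Proof.
rewrite -big_split; apply: eq_bigr => i _; rewrite -big_split; apply: eq_bigr => j _ /=.
by rewrite vecD mulrDl opprD expfzDr ?qq_neq0.
Qed.

Lemma chiDr m r r' : chi m (r + r') = chi m r * chi m r'.
Proof.
rewrite -big_split; apply: eq_bigr => i _; rewrite -big_split; apply: eq_bigr => j _ /=.
by rewrite vecD mulrDr opprD expfzDr ?qq_neq0.
Qed.

Lemma chi_neq0 m r : chi m r != 0.
Proof.
apply/prodf_neq0 => i _; apply/prodf_neq0 => j _.
exact/expfz_neq0/qq_neq0.
Qed.

Lemma chi_unit_vec u v : chi (unit_vec u) (unit_vec v) = (qq v u)^-1.
Proof.
rewrite /chi (bigD1 v) //= (bigD1 u) //= !unit_vecE !eqxx mulr1 big1 => [|j nj].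
  rewrite mulr1 big1 ?mulr1 => [|i ni]; first by rewrite -[LHS]/((qq v u)^-1).
  by apply: big1 => j _; rewrite !unit_vecE (negPf ni) mulr0 oppr0 expr0z.
by rewrite unit_vecE (negPf nj) mul0r oppr0 expr0z.
Qed.

Lemma chi_unit u : chi (unit_vec u) (unit_vec u) = 1.
Proof. by rewrite chi_unit_vec /qq ltnn invr1. Qed.

Lemma chi_comm (i j : 'I_n) : (i < j)%N ->
  chi (unit_vec i) (unit_vec j) = q i j * chi (unit_vec j) (unit_vec i).
Proof.
move=> ij; rewrite !chi_unit_vec /qq ij ltnNge (ltnW ij) /= invr1.
by rewrite mulfV // q_neq0.
Qed.

End Bicharacter.

(** * The sum of the monomial cyclic modules *)

Section Module.
Variables (k : fieldType) (n : nat) (a : 'I_n -> nat) (q : 'I_n -> 'I_n -> k).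
Hypothesis q_neq0 : forall i j : 'I_n, (i < j)%N -> q i j != 0.
Local Notation vec := (vec n).
Local Notation chi := (chi q).
Local Notation inbox := (inbox a).
Local Notation box := (box a).
Implicit Types i j l m r : vec.

Let cDl := chiDl q_neq0.
Let cDr := chiDr q_neq0.
Let c_neq0 := chi_neq0 q_neq0.
Let c0r m : chi m 0 = 1 := chi0r cDr c_neq0 m.
Let c0l m : chi 0 m = 1 := chi0l cDl c_neq0 m.

(** The pair (j, m) stands for the monomial X^m of M_j. *)
Definition pair_valid (p : vec * vec) : bool :=
  [forall u, [&& 0 <= p.2 u, p.2 u <= p.1 u & p.1 u < (a u)%:Z]].

Lemma pair_validP j m : reflect
  (forall u, [&& 0 <= m u, m u <= j u & j u < (a u)%:Z]) (pair_valid (j, m)).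
Proof. exact: forallP. Qed.

Definition pairs : seq (vec * vec) :=
  [seq p <- [seq (j, m) | j <- box, m <- box] | pair_valid p].

Lemma pairs_uniq : uniq pairs.
Proof.
by rewrite filter_uniq // allpairs_uniq ?box_uniq // => -[? ?] [? ?].
Qed.

Lemma mem_pairs p : (p \in pairs) = pair_valid p.
Proof.
rewrite mem_filter; case: p => [j m]; case: pair_validP => //= V.
apply/allpairsP; exists (j, m); rewrite /= !mem_box; split=> //.
  by apply/inboxP => u; have := V u; lia.
by apply/inboxP => u; have := V u; lia.
Qed.

Definition basis := seq_sub pairs.
Definition mspace : lmodType k := {ffun basis -> k^o}.
Implicit Types F G : mspace.

Definition mcoef F (p : vec * vec) : k :=
  if insub p is Some s then (F : {ffun basis -> k^o}) s else 0.

Definition mono (p : vec * vec) (x : k) : mspace :=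
  [ffun s : basis => if val s == p then x else 0].

Lemma mcoef_out F p : ~~ pair_valid p -> mcoef F p = 0.
Proof. by move=> nV; rewrite /mcoef insubN // mem_pairs. Qed.

Lemma mcoef_val F (s : basis) : mcoef F (val s) = (F : {ffun basis -> k^o}) s.
Proof. by rewrite /mcoef valK. Qed.

Lemma mcoefP F G : (forall p, mcoef F p = mcoef G p) -> F = G.
Proof. by move=> FG; apply/ffunP => s; rewrite -!mcoef_val. Qed.

Lemma mcoefD F G p : mcoef (F + G) p = mcoef F p + mcoef G p.
Proof. by rewrite /mcoef; case: insubP => [s _ _|]; rewrite ?ffunE ?addr0. Qed.

Lemma mcoefZ c F p : mcoef (c *: F) p = c * mcoef F p.
Proof. by rewrite /mcoef; case: insubP => [s _ _|]; rewrite ?ffunE ?mulr0. Qed.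

Lemma mcoef0 p : mcoef 0 p = 0.
Proof. by rewrite -[0](scale0r 0) mcoefZ mul0r. Qed.

Lemma mcoef_sum (I : Type) (s : seq I) (P : pred I) (H : I -> mspace) p :
  mcoef (\sum_(i <- s | P i) H i) p = \sum_(i <- s | P i) mcoef (H i) p.
Proof. by apply: (big_morph (mcoef^~ p)) => [F G|]; [exact: mcoefD|exact: mcoef0]. Qed.

Lemma mcoef_mono p x p' : mcoef (mono p x) p' = if (p' == p) && pair_valid p then x else 0.
Proof.
rewrite /mcoef; case: insubP => [s|]; rewrite mem_pairs => V.
  by move=> E; rewrite ffunE E; case: eqP => // <-; rewrite V.
by case: eqP => // <-; rewrite (negPf V).
Qed.

Lemma mono_out p x : ~~ pair_valid p -> mono p x = 0.
Proof. by move=> /negPf nV; apply: mcoefP => p'; rewrite mcoef_mono nV andbF mcoef0. Qed.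

Lemma monoD p x y : mono p (x + y) = mono p x + mono p y.
Proof. by apply: mcoefP => p'; rewrite mcoefD !mcoef_mono; case: ifP; rewrite ?addr0. Qed.

Lemma monoZ c p x : c *: mono p x = mono p (c * x).
Proof. by apply: mcoefP => p'; rewrite mcoefZ !mcoef_mono; case: ifP; rewrite ?mulr0. Qed.

Lemma mono0 p : mono p 0 = 0.
Proof. by apply: mcoefP => p'; rewrite mcoef0 mcoef_mono if_same. Qed.

Lemma mono_expand F : F = \sum_(p <- pairs) mono p (mcoef F p).
Proof.
apply: mcoefP => p; rewrite mcoef_sum; have [V|nV] := boolP (pair_valid p).
  rewrite (bigD1_seq p) ?mem_pairs ?pairs_uniq //= mcoef_mono eqxx V /=.
  by rewrite big1 ?addr0 // => p' np; rewrite mcoef_mono eq_sym (negPf np).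
rewrite mcoef_out // big_seq big1 // => p' _; rewrite mcoef_mono.
by case: eqP => //= <-; rewrite (negPf nV).
Qed.

Lemma mono_ind (P : mspace -> Prop) :
    P 0 -> (forall F G, P F -> P G -> P (F + G)) ->
    (forall j m x, pair_valid (j, m) -> P (mono (j, m) x)) ->
  forall F, P F.
Proof.
move=> P0 PD PM F; rewrite [F]mono_expand big_seq.
by apply: big_ind => // -[j m]; rewrite mem_pairs; apply: PM.
Qed.

Section MonomialMap.
Variables (f : vec * vec -> vec * vec) (s : vec * vec -> k).

Definition mono_map F : mspace := \sum_(p <- pairs) mono (f p) (s p * mcoef F p).

Lemma mono_map_linear : linear mono_map.
Proof.
move=> c F G; rewrite scaler_sumr -big_split; apply: eq_bigr => p _ /=.
by rewrite monoZ -monoD mcoefD mcoefZ mulrDr mulrCA.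
Qed.

Lemma mono_map_mono p x : pair_valid p -> mono_map (mono p x) = mono (f p) (s p * x).
Proof.
move=> V; rewrite /mono_map (bigD1_seq p) ?mem_pairs ?pairs_uniq //= mcoef_mono eqxx V.
rewrite big1 ?addr0 // => p' np.
by rewrite mcoef_mono (negPf np) mulr0 mono0.
Qed.

End MonomialMap.

Definition nonneg (m : vec) := forall u, 0 <= m u.

Lemma pair_valid_nonneg j m : pair_valid (j, m) -> nonneg m.
Proof. by move=> /pair_validP V u; have /andP[] := V u. Qed.

Lemma pair_valid_sub j m r : nonneg m -> nonneg r ->
  pair_valid (j, m + r) -> pair_valid (j, m).
Proof.
move=> m0 r0 /pair_validP V; apply/pair_validP => u.
by have := V u; have := m0 u; have := r0 u; rewrite vecE; lia.
Qed.

Lemma nonneg_unit u : nonneg (unit_vec u).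
Proof. by move=> v; rewrite unit_vecE; case: eqP. Qed.

Lemma nonnegD m r : nonneg m -> nonneg r -> nonneg (m + r).
Proof. by move=> m0 r0 u; rewrite vecE; have := m0 u; have := r0 u; lia. Qed.

Lemma nonneg0 : nonneg 0.
Proof. by move=> u; rewrite vecE. Qed.

Definition mulX u : {linear mspace -> mspace} :=
  mklin (mono_map_linear (fun p => (p.1, p.2 + unit_vec u)) (fun p => chi (unit_vec u) p.2)).

Lemma mulX_mono u j m x : nonneg m ->
  mulX u (mono (j, m) x) = mono (j, m + unit_vec u) (chi (unit_vec u) m * x).
Proof.
move=> m0; have [V|nV] := boolP (pair_valid (j, m)).
  by rewrite mklinE mono_map_mono.
rewrite (mono_out _ nV) linear0 mono_out //; apply: contra nV.
exact: pair_valid_sub m0 (nonneg_unit u).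
Qed.

Lemma iter_mulX u p j m x : nonneg m ->
  exists c, iter p (mulX u) (mono (j, m) x) = mono (j, m + unit_vec u *+ p) c.
Proof.
move=> m0; have up0 (t : nat) : nonneg (m + unit_vec u *+ t).
  by elim: t => [|t IH]; rewrite ?addr0 // mulrSr addrA; apply: nonnegD (nonneg_unit u).
elim: p => [|p [c IH]]; first by exists x; rewrite addr0.
rewrite iterS IH mulX_mono // mulrSr addrA; by eexists.
Qed.

Lemma mulX_pow u F : iter (a u) (mulX u) F = 0.
Proof.
have itD p G H : iter p (mulX u) (G + H) = iter p (mulX u) G + iter p (mulX u) H.
  by elim: p => [|p IH] //; rewrite !iterS IH linearD.
move: F; apply: mono_ind => [|F G IF IG|j m x V].
- by elim: (a u) => [|p IH] //; rewrite iterS IH linear0.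
- by rewrite itD IF IG addr0.
have [c ->] := iter_mulX u (a u) j x (pair_valid_nonneg V).
rewrite mono_out //; apply/pair_validP => /(_ u).
move/pair_validP/(_ u): V; rewrite !vecE eqxx; lia.
Qed.

Lemma mulX_comm (i j : 'I_n) (F : mspace) : (i < j)%N ->
  mulX i (mulX j F) = q i j *: mulX j (mulX i F).
Proof.
move=> ij; move: F; apply: mono_ind => [|F G IF IG|l m x V].
- by rewrite !linear0.
- by rewrite !linearD IF IG.
have m0 := pair_valid_nonneg V.
rewrite !mulX_mono //; try exact/nonnegD/nonneg_unit.
rewrite monoZ addrAC; congr (mono _ _).
by rewrite !cDr (chi_comm q_neq0 ij); ring.
Qed.

Definition mon_module : lmodType (qci a q) := qrep mulX_pow mulX_comm.

Implicit Types X Y : mon_module.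
Local Notation L := (qci a q).
Local Notation qci_gen := (qci_gen a q).
Local Notation qci_cst := (qci_cst a q).

Lemma qci_gen_mono u j m x : nonneg m ->
  qci_gen u *: (mono (j, m) x : mon_module) = mono (j, m + unit_vec u) (chi (unit_vec u) m * x).
Proof. by move=> m0; rewrite qci_gen_act mulX_mono. Qed.

Lemma qci_cst_mono c p x : qci_cst c *: (mono p x : mon_module) = mono p (c * x).
Proof. by rewrite qci_cst_act; apply: monoZ. Qed.

Definition wdeg (w : seq 'I_n) : vec := \sum_(u <- w) unit_vec u.

Lemma wdeg_nonneg w : nonneg (wdeg w).
Proof.
by rewrite /wdeg; elim/big_ind: _ => [|x y|u _]; [exact: nonneg0|exact: nonnegD|exact: nonneg_unit].
Qed.

(** The scalar c depends on the order of the letters. *)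
Lemma word_mono w m : nonneg m -> exists2 c, c != 0 & forall j x,
  (\prod_(u <- w) qci_gen u) *: (mono (j, m) x : mon_module) = mono (j, m + wdeg w) (c * x).
Proof.
move=> m0; elim: w => [|u w [c c0 IH]].
  by exists 1; rewrite ?oner_neq0 // => j x; rewrite /wdeg !big_nil scale1r addr0 mul1r.
exists (chi (unit_vec u) (m + wdeg w) * c); first by rewrite mulf_neq0.
move=> j x; rewrite big_cons -scalerA IH qci_gen_mono; last exact/nonnegD/wdeg_nonneg.
by rewrite /wdeg big_cons mulrA [unit_vec u + _]addrC addrA.
Qed.

Definition std_word (m : vec) : seq 'I_n := flatten [seq nseq `|m u|%N u | u : 'I_n].

Lemma wdeg_std m : nonneg m -> wdeg (std_word m) = m.
Proof.
move=> m0; apply/ffunP => v; rewrite /wdeg big_flatten /= big_map.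
have E u : \sum_(v <- nseq `|m u|%N u) unit_vec v = unit_vec u *+ `|m u|%N :> vec.
  by elim: `|m u|%N => [|p IH]; rewrite ?big_nil // big_cons IH mulrS.
under eq_bigr => u _ do rewrite E.
rewrite sum_ffunE (bigD1_seq v) ?mem_enum ?enum_uniq //= big1 ?addr0.
  rewrite [LHS]vecMn unit_vecE eqxx mul1r gez0_abs //; exact: m0.
by move=> u nu; rewrite [LHS]vecMn unit_vecE eq_sym (negPf nu) mul0r.
Qed.

Lemma mono_gen i m x : nonneg m -> exists y : L, y *: (mono (i, 0) 1 : mon_module) = mono (i, m) x.
Proof.
move=> m0; have [c c0 wE] := word_mono (std_word m) nonneg0.
exists (qci_cst (x / c) * \prod_(u <- std_word m) qci_gen u).
by rewrite -scalerA wE qci_cst_mono add0r wdeg_std // mulr1 divfK.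
Qed.

End Module.

(** * The endomorphism algebra *)

Section Endomorphisms.
Variables (k : fieldType) (n : nat) (a : 'I_n -> nat) (q : 'I_n -> 'I_n -> k).
Hypothesis q_neq0 : forall i j : 'I_n, (i < j)%N -> q i j != 0.
Local Notation vec := (vec n).
Local Notation chi := (chi q).
Local Notation inbox := (inbox a).
Local Notation box := (box a).
Local Notation valid := (valid a).
Local Notation pair_valid := (pair_valid a).
Local Notation mono := (@mono k n a).
Local Notation mcoef := (@mcoef k n a).
Local Notation M := (mon_module a q_neq0).
Local Notation L := (qci a q).
Local Notation A := (endo M).
Local Notation qci_gen := (qci_gen a q).
Local Notation qci_cst := (qci_cst a q).
Implicit Types i j l m r : vec.

Let cDl := chiDl q_neq0.
Let cDr := chiDr q_neq0.
Let c_neq0 := chi_neq0 q_neq0.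
Let c0r m : chi m 0 = 1 := chi0r cDr c_neq0 m.
Let c0l m : chi 0 m = 1 := chi0l cDl c_neq0 m.

Lemma qci_gen_mulX u (F : M) : qci_gen u *: F = mulX a q u F.
Proof. by rewrite qci_gen_act. Qed.

Definition arrow_scalar (t : mor n) (x : k) (p : vec * vec) : k :=
  if valid t && (p.1 == t.1.1) then chi p.2 t.1.2 * x else 0.

Definition arrow_fun (t : mor n) (x : k) (F : M) : M :=
  mono_map (fun p => (t.2, p.2 + t.1.2)) (arrow_scalar t x) F.

Lemma arrow_fun_mono i m j x i' r y : nonneg r ->
  arrow_fun (i, m, j) x (mono (i', r) y) =
    if valid (i, m, j) && (i' == i) then mono (j, r + m) (chi r m * x * y) else 0.
Proof.
move=> r0; have [V|nV] := boolP (pair_valid (i', r)).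
  rewrite /arrow_fun mono_map_mono // /arrow_scalar /=; case: ifP => // _.
  by rewrite mul0r mono0.
rewrite (mono_out _ nV) /arrow_fun -[mono_map _ _ 0](mklinE (mono_map_linear _ _)) linear0.
case: ifP => // /andP[/validP Vt /eqP ii]; rewrite mono_out //; apply: contra nV.
rewrite ii => /pair_validP V; apply/pair_validP => u.
by have := V u; have := Vt u; have := r0 u; rewrite vecE; lia.
Qed.

(** Left multiplication by X_u and the arrow, a right multiplication by X^m,
    commute by associativity; on monomials this is the bimultiplicativity of
    [chi]. *)
Lemma arrow_linear t x : linear (arrow_fun t x).
Proof.
have fD F G : arrow_fun t x (F + G) = arrow_fun t x F + arrow_fun t x G.
  exact: (linearD (mklin (mono_map_linear _ _))).
apply: (qci_linear fD).
  move=> c F; rewrite qci_cst_act [RHS]qci_cst_act.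
  exact: (linearZ_LR (mklin (mono_map_linear _ _))).
move=> u F; case: t fD => [[i m] j] fD.
have f0 : arrow_fun (i, m, j) x 0 = 0.
  exact: (linear0 (mklin (mono_map_linear _ _))).
move: F; apply: mono_ind => [|F G IF IG|i' r y V].
- by rewrite scaler0 f0 scaler0.
- by rewrite scalerDr !fD IF IG scalerDr.
have r0 := pair_valid_nonneg V.
rewrite qci_gen_mono // !arrow_fun_mono //; last exact/nonnegD/nonneg_unit.
case: ifP => [/andP[/validP Vt _]|_]; last by rewrite scaler0.
rewrite qci_gen_mono; last by move=> v; have := Vt v; have := r0 v; rewrite vecE; lia.
by rewrite addrAC cDl cDr; congr (mono _ _); ring.
Qed.

Definition arrow (t : mor n) (x : k) : A := mklin (arrow_linear t x).

Lemma arrow_mono i m j x i' r y : nonneg r ->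
  arrow (i, m, j) x (mono (i', r) y : M) =
    if valid (i, m, j) && (i' == i) then mono (j, r + m) (chi r m * x * y) else 0.
Proof. exact: arrow_fun_mono. Qed.

Definition arrow_coef (f : A) (t : mor n) : k := mcoef (f (mono (t.1.1, 0) 1 : M)) (t.2, t.1.2).

Lemma endo_addE (f g : A) (v : M) : (f + g) v = f v + g v.
Proof. by []. Qed.

Lemma endo_sumE (I : Type) (s : seq I) (P : pred I) (F : I -> A) (v : M) :
  (\sum_(i <- s | P i) F i) v = \sum_(i <- s | P i) F i v.
Proof. by apply: (big_morph (fun f : A => f v)). Qed.

Lemma endo_r0 (f : A) : f (0 : M) = 0.
Proof. exact: linear0. Qed.

Lemma endo_mulE (f g : A) (v : M) : (f * g) v = f (g v).
Proof. by []. Qed.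

Lemma endo_mono_eq (f g : A) :
    (forall i m x, pair_valid (i, m) -> f (mono (i, m) x : M) = g (mono (i, m) x : M)) ->
  f = g.
Proof.
move=> fg; apply: endoP => F; move: F; apply: mono_ind => [|F G IF IG|]; last exact: fg.
- by rewrite !linear0.
- by rewrite !linearD IF IG.
Qed.

Lemma endo_gen_eq (f g : A) :
    (forall i, f (mono (i, 0) 1 : M) = g (mono (i, 0) 1 : M)) ->
  f = g.
Proof.
move=> fg; apply: endo_mono_eq => i m x /pair_valid_nonneg m0.
have [y <-] := mono_gen a q_neq0 i x m0.
by rewrite (linearZ_LR f) (linearZ_LR g) fg.
Qed.

Lemma arrowD t x y : arrow t (x + y) = arrow t x + arrow t y.
Proof.
case: t => [[i m] j]; apply: endo_mono_eq => i' r z /pair_valid_nonneg r0.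
rewrite endo_addE !arrow_mono //; case: ifP; rewrite ?addr0 // => _.
by rewrite mulrDr mulrDl monoD.
Qed.

Lemma arrow_out t x : ~~ valid t -> arrow t x = 0.
Proof.
case: t => [[i m] j] /negPf nV; apply: endo_mono_eq => i' r z /pair_valid_nonneg r0.
by rewrite arrow_mono // nV.
Qed.

Lemma arrow_mul i m j m' l x y : valid (i, m, j) -> valid (j, m', l) ->
  arrow (j, m', l) y * arrow (i, m, j) x = arrow (i, m + m', l) (chi m m' * (x * y)).
Proof.
move=> V V'; apply: endo_mono_eq => i' r z /pair_valid_nonneg r0.
rewrite endo_mulE !arrow_mono // V andTb; case: (i' == i); last by rewrite andbF endo_r0.
have rm0 : nonneg (r + m).
  by apply: nonnegD => // u; move/validP/(_ u): V; lia.
rewrite arrow_mono // V' eqxx /= andbT addrA.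
case: ifP => [_|nV]; first by congr (mono _ _); rewrite cDl cDr; ring.
apply: mono_out; apply: contraFN nV => /pair_validP W; apply/validP => u.
by have := W u; move/validP/(_ u): V; move/validP/(_ u): V'; have := r0 u; rewrite !vecE; lia.
Qed.

Lemma arrow_mul0 i m j j' m' l x y : j != j' ->
  arrow (j', m', l) y * arrow (i, m, j) x = 0.
Proof.
move=> /negPf nj; apply: endo_mono_eq => i' r z /pair_valid_nonneg r0.
rewrite endo_mulE arrow_mono //; case: ifP => [/andP[V _]|_]; last exact: endo_r0.
rewrite arrow_mono ?nj ?andbF //.
by apply: nonnegD => // u; move/validP/(_ u): V; lia.
Qed.

Lemma arrow_coefD f g t : arrow_coef (f + g) t = arrow_coef f t + arrow_coef g t.
Proof. by rewrite /arrow_coef endo_addE mcoefD. Qed.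

Lemma arrow_coefE t x t' : valid t ->
  arrow_coef (arrow t x) t' = if t' == t then x else 0.
Proof.
case: t t' => [[i m] j] [[i' m'] j'] V.
rewrite -[LHS]/(mcoef (arrow (i, m, j) x (mono (i', 0) 1 : M)) (j', m')) arrow_mono;
  last exact: nonneg0.
rewrite V andTb !xpair_eqE; case: (i' == i); last by rewrite mcoef0.
rewrite mcoef_mono add0r c0l mul1r mulr1 xpair_eqE [(m' == m) && _]andbC.
suff -> : pair_valid (j, m) by rewrite andbT.
by apply/pair_validP => u; move/validP/(_ u): V; lia.
Qed.

Lemma arrow_one : 1 = \sum_(i <- box) arrow (i, 0, i) 1.
Proof.
apply: endo_mono_eq => i r x V; have r0 := pair_valid_nonneg V.
have ib : inbox i by apply/inboxP => u; move/pair_validP/(_ u): V; lia.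
rewrite endo_sumE; under eq_bigr => j _ do rewrite arrow_mono // valid_id.
rewrite (bigD1_seq i) ?mem_box ?box_uniq //= ib eqxx c0r addr0 !mul1r.
by rewrite big1 ?addr0 // => j nj; rewrite eq_sym (negPf nj) andbF.
Qed.

Lemma mcoef_mulX u F j m : nonneg m -> pair_valid (j, m + unit_vec u) ->
  mcoef (mulX a q u F) (j, m + unit_vec u) = chi (unit_vec u) m * mcoef F (j, m).
Proof.
move=> m0 V; have V' := pair_valid_sub m0 (@nonneg_unit n u) V.
move: F; apply: mono_ind => [|F G IF IG|i r x W].
- by rewrite linear0 !mcoef0 mulr0.
- by rewrite linearD !mcoefD IF IG mulrDr.
have r0 := pair_valid_nonneg W.
rewrite mulX_mono // !mcoef_mono W andbT !xpair_eqE (inj_eq (addIr _)).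
case: (j =P i) => [<-|_] /=; last by rewrite mulr0.
case: (m =P r) => [<-|_] /=; last by rewrite mulr0.
by rewrite V.
Qed.

Lemma mcoef_iter_mulX u p F j m : nonneg m -> pair_valid (j, m + unit_vec u *+ p) ->
  mcoef (iter p (mulX a q u) F) (j, m + unit_vec u *+ p) = 0 -> mcoef F (j, m) = 0.
Proof.
move=> m0; elim: p => [|p IH]; first by rewrite addr0.
have up0 : nonneg (m + unit_vec u *+ p).
  by move=> v; rewrite !vecE; have := m0 v; case: eqP; lia.
rewrite mulrSr addrA => V; rewrite iterS mcoef_mulX // => /eqP.
rewrite mulf_eq0 (negPf (c_neq0 _ _)) /= => /eqP; apply: IH.
exact: pair_valid_sub up0 (@nonneg_unit n u) V.
Qed.

(** The generator of M_i is killed by X_u^(i_u + 1), and so are its images. *)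
Lemma endo_support (f : A) i m j :
  ~~ valid (i, m, j) -> mcoef (f (mono (i, 0) 1 : M)) (j, m) = 0.
Proof.
move=> nV; have [W|nW] := boolP (pair_valid (j, m)); last exact: mcoef_out.
have [ib|nib] := boolP (inbox i); last first.
  rewrite (_ : mono (i, 0) 1 = 0) ?linear0 ?mcoef0 // mono_out //.
  apply: contra nib => /pair_validP V; apply/inboxP => u; have := V u; rewrite vecE; lia.
have m0 := pair_valid_nonneg W.
have [u ju] : exists u, m u + i u < j u.
  apply: contrapT => nex; case/negP: nV; apply/validP => u.
  have : ~~ (m u + i u < j u) by apply/negP => h; apply: nex; exists u.
  by move/pair_validP/(_ u): W; move/inboxP/(_ u): ib; lia.
have iu0 : 0 <= i u by move/inboxP/(_ u): ib; lia.
apply: (@mcoef_iter_mulX u `|i u|.+1) => //.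
  apply/pair_validP => v; move/pair_validP/(_ v): W; rewrite !vecE.
  have [->|nv] := eqVneq v u; last by rewrite mul0r addr0.
  lia.
have fX p (F : M) : (iter p (mulX a q u) (f F) : M) = f (iter p (mulX a q u) F : M).
  elim: p F => [|p IH] F //; rewrite !iterSr -IH; congr (iter _ _ _).
  by rewrite -!qci_gen_mulX (linearZ_LR f).
rewrite fX; have [c ->] := iter_mulX a q u `|i u|.+1 i 1 (@nonneg0 n).
rewrite mono_out ?linear0 ?mcoef0 //; apply/pair_validP => /(_ u).
by rewrite !vecE eqxx; lia.
Qed.

(** An endomorphism is determined by its values at the generators of the M_i,
    whose monomials are those of the arrows, by [endo_support]. *)
Lemma arrow_expand f : f = \sum_(t <- mors a) arrow t (arrow_coef f t).
Proof.
apply: endo_gen_eq => i; apply: mcoefP => -[j m].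
rewrite endo_sumE mcoef_sum.
have E t : mcoef (arrow t (arrow_coef f t) (mono (i, 0) 1 : M)) (j, m) =
    if valid t && (t == (i, m, j)) then mcoef (f (mono (i, 0) 1 : M)) (j, m) else 0.
  have [V|nV] := boolP (valid t); last by rewrite arrow_out ?mcoef0.
  by rewrite -[LHS]/(arrow_coef _ (i, m, j)) arrow_coefE // eq_sym; case: eqP => [->|].
under eq_bigr => t _ do rewrite E.
have [V|nV] := boolP (valid (i, m, j)).
  rewrite (bigD1_seq (i, m, j)) ?mem_mors ?mors_uniq //= V eqxx big1 ?addr0 // => t nt.
  by rewrite (negPf nt) andbF.
by rewrite endo_support // big1 // => t _; case: ifP.
Qed.

Lemma gldim_endo_mon_module : leqe (gldim A) (Some (2 * n)%N).
Proof.
rewrite mul2n -addnn; apply: gldim_le.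
exact: (monomial_algebra_pd_le cDl cDr c_neq0 (chi_unit q) arrowD arrow_out
  arrow_mul arrow_mul0 arrow_expand arrow_coefD arrow_coefE arrow_one).
Qed.

End Endomorphisms.

(** * Summands, generators and minimal generating families *)

Section Summands.
Variable R : pzRingType.
Implicit Types E M N : lmodType R.

Lemma retract_split N M (s : {linear N -> M}) (r : {linear M -> N}) :
    cancel s r ->
  exists2 f : {linear (N * kernel r)%type -> M}, bijective f &
    forall x z, f (x, z) = s x + val z.
Proof.
move=> rK; have flin : linear (fun z : N * kernel r => s z.1 + val z.2).
  by move=> c x y /=; rewrite !linearP scalerDr addrACA.
have rker (z : kernel r) : r (val z) = 0 by case: z => z /= /eqP.
exists (mklin flin) => //.
have [||g [gK Kg]] := @bijective_of _ _ _ (mklin flin); last by exists g.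
- apply: linear_inj0 => -[x z]; rewrite mklinE /= => xz0.
  have x0 : x = 0.
    by have := congr1 r xz0; rewrite linearD rK rker addr0 linear0.
  congr (_, _) => //; apply: val_inj.
  by move: xz0; rewrite x0 linear0 add0r.
- move=> y; have [|z zE] := (ker_incl_exact r (y - s (r y))).1.
    by rewrite linearB rK subrr.
  by exists (r y, z); rewrite mklinE /= -[val z]/(ker_incl r z) zE addrC subrK.
Qed.

Lemma retract_summand N M (s : {linear N -> M}) (r : {linear M -> N}) :
  cancel s r -> direct_summand N M.
Proof. by move=> /retract_split[f bij_f _]; exists (kernel r), f. Qed.

(** The complement of N in E must vanish. *)
Lemma indecomposable_retract E N (s : {linear N -> E}) (h : {linear E -> N}) :
  cancel s h -> ~ zero_module N -> indecomposable E -> cancel h s.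
Proof.
move=> hK nz [_ indE]; have [f bij_f fE] := retract_split hK.
have [//|ker0] := indE _ _ f bij_f.
have [g _ gK] := bij_f; move=> y; rewrite -[y]gK; case: (g y) => x z.
rewrite fE; have -> : val z = 0 by rewrite (ker0 z).
by rewrite addr0 hK.
Qed.

Lemma summand_transfer E N M (s : {linear N -> E}) (h : {linear E -> N})
    (s' : {linear N -> M}) (r' : {linear M -> N}) :
    cancel s h -> ~ zero_module N -> indecomposable E -> cancel s' r' ->
  direct_summand E M.
Proof.
move=> hK nz indE rK; have sK := indecomposable_retract hK nz indE.
by apply: (@retract_summand _ _ (s' \o h) (s \o r')) => x /=; rewrite rK sK.
Qed.

Inductive spanned (M : lmodType R) (s : seq M) : M -> Prop :=
| Spanned0 : spanned s 0
| SpannedD x y : spanned s x -> spanned s y -> spanned s (x + y)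
| SpannedZ c x : x \in s -> spanned s (c *: x).

Lemma spanned_fin_gen M (s : seq M) : (forall x, spanned s x) -> fin_gen M.
Proof.
move=> sp; exists s => x; elim: {x}(sp x) => [|x y _ [c ->] _ [d ->]|c x xs].
- by exists (fun=> 0); rewrite big1 // => i _; rewrite scale0r.
- exists (fun i => c i + d i); rewrite -big_split; apply: eq_bigr => i _.
  by rewrite scalerDl.
have ix : (index x s < size s)%N by rewrite index_mem.
exists (fun i => if i == Ordinal ix then c else 0).
rewrite (bigD1 (Ordinal ix)) //= eqxx nth_index // big1 ?addr0 // => i /negPf ->.
by rewrite scale0r.
Qed.

End Summands.

(** Here R is a local ring and [eps] is the map to its residue field. *)
Section LocalRing.
Variables (R K : pzRingType) (eps : {rmorphism R -> K}).
Hypothesis eps_unit : forall y, eps y <> 0 -> exists z, z * y = 1.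

(** In a generating family of minimal size no member is a combination of the
    others, so that no relation has an invertible coefficient. *)
Lemma local_coordinates (M : lmodType R) : fin_gen M ->
  exists (r : nat) (p : 'I_r -> M), (forall x, exists c : 'I_r -> R, x = \sum_i c i *: p i) /\
    forall i, exists f : {linear M -> res eps K^o},
      forall c : 'I_r -> R, f (\sum_j c j *: p j) = eps (c i).
Proof.
case=> s gen_s.
pose gens r := exists p : 'I_r -> M, forall x, exists c : 'I_r -> R, x = \sum_i c i *: p i.
have : exists r, `[< gens r >] by exists (size s); apply/asboolP; exists (fun i => s`_i).
move=> /ex_minnP[r /asboolP[p gen_p] min_r]; exists r, p; split=> // i.
have rel (c : 'I_r -> R) : \sum_j c j *: p j = 0 -> eps (c i) = 0.
  move=> c0; apply: contrapT => /eps_unit[z zc].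
  case: r p gen_p min_r i c c0 zc => [|r] p gen_p min_r i c c0 zc; first by case: i {zc}.
  suff : gens r by move=> /asboolP/min_r; rewrite ltnn.
  exists (fun j => p (lift i j)) => x; have [d ->] := gen_p x.
  have pi : p i = - \sum_j (z * c (lift i j)) *: p (lift i j).
    have : z *: \sum_j c j *: p j = 0 by rewrite c0 scaler0.
    rewrite (bigD1_ord i) //= scalerDr scalerA zc scale1r scaler_sumr => /eqP.
    by rewrite addr_eq0 => /eqP ->; congr (- _); apply: eq_bigr => j _; rewrite scalerA.
  exists (fun j => d (lift i j) - d i * (z * c (lift i j))).
  rewrite (bigD1_ord i) //= pi scalerN scaler_sumr addrC -sumrB.
  by apply: eq_bigr => j _; rewrite scalerBl scalerA.
have [f fE] := choice gen_p; pose phi x : K := eps (f x i).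
have phiE (c : 'I_r -> R) : phi (\sum_j c j *: p j) = eps (c i).
  apply/eqP; rewrite -subr_eq0 /phi -rmorphB; apply/eqP.
  apply: (rel (fun j => f _ j - c j)).
  by under eq_bigr => j _ do rewrite scalerBl; rewrite sumrB -fE subrr.
have phi_lin : linear (phi : M -> res eps K^o).
  move=> a x y; have [c ->] := gen_p x; have [d ->] := gen_p y.
  rewrite scaler_sumr -big_split /=.
  under eq_bigr => j _ do rewrite scalerA -scalerDl.
  by rewrite !phiE rmorphD rmorphM.
by exists (mklin phi_lin).
Qed.

End LocalRing.

(** * Words in the generators *)

Section Words.
Variables (k : fieldType) (n : nat) (a : 'I_n -> nat) (q : 'I_n -> 'I_n -> k).
Hypothesis q_neq0 : forall i j : 'I_n, (i < j)%N -> q i j != 0.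
Variables (L : pzRingType) (gen : 'I_n -> L) (cst : {rmorphism k -> L}).
Hypothesis cst_comm : forall c y, cst c * y = y * cst c.
Hypothesis gen_pow : forall u, gen u ^+ a u = 0.
Hypothesis gen_comm : forall i j : 'I_n, (i < j)%N ->
  gen i * gen j = cst (q i j) * (gen j * gen i).
Hypothesis gen_ind : forall P : L -> Prop,
  P 0 -> (forall x y, P x -> P y -> P (x + y)) ->
  (forall c w, P (cst c * \prod_(u <- w) gen u)) -> forall y, P y.
Local Notation vec := (vec n).
Local Notation inbox := (inbox a).
Local Notation box := (box a).

Definition word (w : seq 'I_n) : L := \prod_(u <- w) gen u.

Lemma word_nil : word [::] = 1.
Proof. exact: big_nil. Qed.

Lemma word_cons u w : word (u :: w) = gen u * word w.
Proof. exact: big_cons. Qed.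

Lemma word_cat w w' : word (w ++ w') = word w * word w'.
Proof. exact: big_cat. Qed.

Lemma gen_swap u v : exists2 c, c != 0 & gen v * gen u = cst c * (gen u * gen v).
Proof.
case: (ltngtP v u) => [vu|uv|/val_inj ->].
- by exists (q v u); [exact: q_neq0|exact: gen_comm].
- exists (q u v)^-1; first by rewrite invr_neq0 // q_neq0.
  by rewrite (gen_comm uv) mulrA -rmorphM mulVf ?q_neq0 // rmorph1 mul1r.
- by exists 1; rewrite ?oner_neq0 // rmorph1 mul1r.
Qed.

Lemma word_swap u w : exists2 c, c != 0 & word w * gen u = cst c * (gen u * word w).
Proof.
elim: w => [|v w [c c0 IH]].
  by exists 1; rewrite ?oner_neq0 // word_nil mulr1 mul1r rmorph1 mul1r.
have [d d0 E] := gen_swap u v; exists (c * d); first exact: mulf_neq0.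
rewrite word_cons -mulrA IH (mulrA (gen v)) -cst_comm -(mulrA (cst c)) (mulrA (gen v)) E.
by rewrite rmorphM -!mulrA.
Qed.

Lemma word_perm w w' : perm_eq w w' -> exists2 c, c != 0 & word w = cst c * word w'.
Proof.
elim: w w' => [|u w IH] w'.
  by rewrite perm_sym => /perm_nilP ->; exists 1; rewrite ?oner_neq0 // rmorph1 mul1r.
move=> ww'; have uw' : u \in w' by rewrite -(perm_mem ww') mem_head.
case/splitPr: uw' ww' => [s1 s2] ww'.
have {}ww' : perm_eq w (s1 ++ s2).
  by rewrite -(perm_cons u) (permPl ww') (perm_catCA s1 [:: u] s2).
have [c c0 E] := IH _ ww'; have [d d0 E'] := word_swap u s1.
exists (c / d); first by rewrite mulf_neq0 ?invr_neq0.
rewrite !word_cons word_cat word_cons E word_cat (mulrA (gen u)) -cst_comm.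
rewrite [in RHS](mulrA (word s1)) E' -!mulrA [RHS](mulrA (cst _)) -rmorphM divfK //.
Qed.

Lemma word_nseq p u : word (nseq p u) = gen u ^+ p.
Proof. by elim: p => [|p IH]; rewrite ?word_nil // word_cons IH exprS. Qed.

(** Up to a nonzero scalar the letters u can be moved to the front. *)
Lemma word_vanish u w : (a u <= count_mem u w)%N -> word w = 0.
Proof.
move=> au; have [|c _ ->] := @word_perm w ([seq v <- w | v == u] ++ [seq v <- w | v != u]).
  by rewrite perm_sym perm_filterC.
have -> : [seq v <- w | v == u] = nseq (count_mem u w) u.
  by have := filter_all (pred1 u) w; move/all_pred1P; rewrite size_filter.
rewrite word_cat word_nseq -(subnKC au) exprD gen_pow !mul0r mulr0 //.
Qed.

Lemma wdeg_count (w : seq 'I_n) u : wdeg w u = (count_mem u w)%:Z.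
Proof.
elim: w => [|v w IH]; first by rewrite /wdeg big_nil vec0.
rewrite /wdeg big_cons vecD -/(wdeg w) IH /= unit_vecE eq_sym PoszD.
by congr (_ + _); case: (v == u).
Qed.

Lemma wdeg_perm (w w' : seq 'I_n) : wdeg w = wdeg w' -> perm_eq w w'.
Proof.
move=> /ffunP ww'; apply/allP => u _ /=; apply/eqP.
by have := ww' u; rewrite !wdeg_count => -[].
Qed.

Lemma box_nonneg (m : vec) : inbox m -> nonneg m.
Proof. by move=> /inboxP mb u; have := mb u; lia. Qed.

(** Reordering puts every word in standard form, and the words of multidegree
    outside of the box vanish. *)
Lemma word_expand (y : L) : exists c : vec -> k,
  y = \sum_(m <- box) cst (c m) * word (std_word m).
Proof.
move: y; apply: gen_ind => [|x y [c ->] [d ->]|c w].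
- by exists (fun=> 0); rewrite big1 // => m _; rewrite rmorph0 mul0r.
- exists (fun m => c m + d m); rewrite -big_split; apply: eq_bigr => m _.
  by rewrite rmorphD mulrDl.
rewrite -/(word w); have [wb|/forallPn[u]] := boolP (inbox (wdeg w)); last first.
  rewrite wdeg_count /= -leNgt lez_nat => au; exists (fun=> 0).
  rewrite big1 => [|m _]; last by rewrite rmorph0 mul0r.
  by rewrite (word_vanish au) mulr0.
have [d _ E] : exists2 d, d != 0 & word w = cst d * word (std_word (wdeg w)).
  by apply/word_perm/wdeg_perm; rewrite wdeg_std //; apply: box_nonneg.
exists (fun m => if m == wdeg w then c * d else 0).
rewrite (bigD1_seq (wdeg w)) ?mem_box ?box_uniq //= eqxx big1 ?addr0 => [|m /negPf ->].
  by rewrite E mulrA rmorphM.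
by rewrite rmorph0 mul0r.
Qed.

(** * The algebra is local *)

Variable aug : {rmorphism L -> k}.
Hypothesis aug_cst : forall c, aug (cst c) = c.
Hypothesis aug_gen : forall u, aug (gen u) = 0.

(** The d-th power of the augmentation ideal, by its spanning words. *)
Inductive deep (d : nat) : L -> Prop :=
| Deep0 : deep d 0
| DeepD y z : deep d y -> deep d z -> deep d (y + z)
| DeepW c w : (d <= size w)%N -> deep d (cst c * word w).

Lemma deepM d e y z : deep d y -> deep e z -> deep (d + e) (y * z).
Proof.
move=> dy dz; elim: dy => [|y1 y2 _ IH1 _ IH2|c w dw].
- by rewrite mul0r; apply: Deep0.
- by rewrite mulrDl; apply: DeepD.
elim: dz => [|z1 z2 _ IH1 _ IH2|c' w' ew'].
- by rewrite mulr0; apply: Deep0.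
- by rewrite mulrDr; apply: DeepD.
have -> : cst c * word w * (cst c' * word w') = cst (c * c') * word (w ++ w').
  by rewrite word_cat rmorphM -!mulrA (mulrA (word w)) -cst_comm -!mulrA.
by apply: DeepW; rewrite size_cat leq_add.
Qed.

Lemma deep_aug y : aug y = 0 -> deep 1 y.
Proof.
suff [z dz E] : exists2 z, deep 1 z & y = cst (aug y) + z.
  by move=> y0; move: E; rewrite y0 rmorph0 add0r => ->.
move: y; apply: gen_ind => [|y1 y2 [z1 d1 E1] [z2 d2 E2]|c [|u w]].
- by exists 0; [exact: Deep0|rewrite rmorph0 rmorph0 addr0].
- exists (z1 + z2); first exact: DeepD.
  by rewrite rmorphD rmorphD addrACA -E1 -E2.
- by exists 0; [exact: Deep0|rewrite big_nil mulr1 aug_cst addr0].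
- exists (cst c * word (u :: w)); first exact: DeepW.
  by rewrite [aug _]rmorphM big_cons [aug (gen u * _)]rmorphM aug_gen mul0r mulr0
    rmorph0 add0r word_cons.
Qed.

(** A word that is too long contains some letter u at least a_u times. *)
Lemma deep_vanish d y : (\sum_u a u < d)%N -> deep d y -> y = 0.
Proof.
move=> ad; elim=> [//|y1 y2 _ -> _ ->|c w dw]; first by rewrite addr0.
suff [u au] : exists u, (a u <= count_mem u w)%N by rewrite (word_vanish au) mulr0.
apply: contrapT => nu; suff : (size w <= \sum_u a u)%N by lia.
have -> : size w = (\sum_u count_mem u w)%N.
  elim: w {dw nu} => [|v w IH] /=; first by rewrite big1.
  rewrite big_split /= -IH (bigD1 v) //= eqxx big1 // => u /negPf.
  by rewrite eq_sym => ->.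
by apply: leq_sum => u _; rewrite leqNgt; apply/negP => h; apply: nu; exists u; apply: ltnW.
Qed.

Lemma aug_nilpotent y : aug y = 0 -> exists p, y ^+ p = 0.
Proof.
move=> /deep_aug dy; exists (\sum_u a u).+1; apply: (@deep_vanish (\sum_u a u).+1) => //.
elim: (_.+1) => [|p IH]; last by rewrite exprS -add1n; apply: deepM.
by rewrite expr0 -word_nil -[word _]mul1r -(rmorph1 cst); apply: DeepW.
Qed.

(** Up to a scalar, y = 1 - x with x nilpotent, and the geometric series of x is
    finite. *)
Lemma aug_unit y : aug y <> 0 -> exists z, z * y = 1 /\ y * z = 1.
Proof.
move=> /eqP y0; set c := aug y in y0.
pose x := 1 - cst c^-1 * y.
have x0 : aug x = 0 by rewrite rmorphB rmorph1 rmorphM aug_cst mulVf // subrr.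
have [p xp] := aug_nilpotent x0.
pose z := \sum_(i < p) x ^+ i.
have zx : (1 - x) * z = 1.
  by apply: oppr_inj; rewrite -mulNr opprB -subrX1 xp sub0r.
have xz : z * (1 - x) = 1.
  have : GRing.comm z (1 - x).
    apply: commr_sym; apply: commr_sum => i _; apply: commrX.
    by apply: commr_sym; apply: commrB; [exact: commr1|exact: commr_refl].
  by move=> ->.
have yE : y = cst c * (1 - x).
  by rewrite /x opprB addrC subrK mulrA -rmorphM mulfV // rmorph1 mul1r.
exists (z * cst c^-1); rewrite {1 2}yE; split.
  by rewrite -mulrA (mulrA (cst c^-1)) -rmorphM mulVf // rmorph1 mul1r.
by rewrite -mulrA (mulrA (1 - x)) zx mul1r -rmorphM mulfV // rmorph1.
Qed.

(** Modulo words of positive length, which kill s, y is its augmentation. *)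
Lemma socle_act (E : lmodType L) (s : E) : (forall u, gen u *: s = 0) ->
  forall y, y *: s = cst (aug y) *: s.
Proof.
move=> s0; apply: gen_ind => [|y z IHy IHz|c w].
- by rewrite rmorph0 rmorph0.
- by rewrite rmorphD rmorphD !scalerDl IHy IHz.
elim/last_ind: w => [|w u _]; first by rewrite big_nil mulr1 aug_cst.
rewrite big_rcons -!scalerA s0 !scaler0 [aug _]rmorphM [aug (_ * gen u)]rmorphM.
by rewrite aug_gen !mulr0 rmorph0 scale0r.
Qed.


(** * Projective and injective modules over the algebra *)

Hypothesis a_gt0 : forall u, (0 < a u)%N.
Local Notation K := (res aug k^o).

Lemma zero_free : ~ zero_module (L^o : lmodType L).
Proof.
by move=> /(_ 1) L10; have := oner_neq0 k; rewrite -(rmorph1 aug) L10 rmorph0 eqxx.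
Qed.

Lemma aug_left_unit y : aug y <> 0 -> exists z, z * y = 1.
Proof. by move=> /aug_unit[z [zy _]]; exists z. Qed.

Lemma scale_linear (E : lmodType L) (x : E) : linear (fun y : L^o => (y : L) *: x).
Proof. by move=> c y z; rewrite [LHS]scalerDl -scalerA. Qed.

(** A nonzero finitely generated projective module maps onto the residue
    field; lifting this map to the algebra gives a split surjection. *)
Lemma projective_retract (P : lmodType L) : fin_gen P -> ~ zero_module P -> projective P ->
  exists (s : {linear L^o -> P}) (h : {linear P -> L^o}), cancel s h.
Proof.
move=> fgP nzP pP; have [r [p [gen_p coord_p]]] := local_coordinates aug_left_unit fgP.
case: r p gen_p coord_p => [|r] p gen_p coord_p.
  by case: nzP => x; have [c ->] := gen_p x; rewrite big_ord0.
have [f fE] := coord_p ord0.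
have augl : linear (fun y : L^o => aug y : K).
  by move=> c y z; rewrite rmorphD rmorphM.
have aug_surj : surjective (mklin augl).
  by move=> c; exists (cst c); rewrite mklinE aug_cst.
have [h hE] := pP _ _ (mklin augl) f aug_surj.
have [z [zh _]] : exists z, z * (h (p ord0) : L) = 1 /\ (h (p ord0) : L) * z = 1.
  apply: aug_unit; rewrite -[aug _]/(mklin augl (h (p ord0))) hE.
  have -> : p ord0 = \sum_j (if j == ord0 then 1 else 0 : L) *: p j.
    by rewrite (bigD1 ord0) //= scale1r big1 ?addr0 // => j /negPf ->; rewrite scale0r.
  by rewrite fE eqxx rmorph1; apply/eqP/oner_neq0.
exists (mklin (scale_linear (z *: p ord0))), h => y.
rewrite mklinE !linearZ_LR /=.
by rewrite -[LHS]/(y * (z * (h (p ord0) : L))) zh mulr1.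
Qed.

Section Cogenerator.
(** The module M is known through its monomials [mon] and the coordinates
    [coord] only; [proj_top] is the projection onto the free summand. *)
Variables (M : lmodType L) (mon : vec * vec -> k -> M) (coord : M -> vec * vec -> k).
Local Notation pair_valid := (pair_valid a).
Hypothesis coordP : forall F G, (forall p, coord F p = coord G p) -> F = G.
Hypothesis coordD : forall F G p, coord (F + G) p = coord F p + coord G p.
Hypothesis coordZ : forall c F p, coord (cst c *: F) p = c * coord F p.
Hypothesis coord_out : forall F p, ~~ pair_valid p -> coord F p = 0.
Hypothesis coord_mon : forall p x p',
  coord (mon p x) p' = if (p' == p) && pair_valid p then x else 0.
Hypothesis word_mon : forall w (m : vec), nonneg m -> exists2 c, c != 0 & forall j x,
  word w *: mon (j, m) x = mon (j, m + wdeg w) (c * x).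
Hypothesis coord_word : forall w (j m : vec), nonneg m -> pair_valid (j, m + wdeg w) ->
  exists2 c, c != 0 & forall F, coord (word w *: F) (j, m + wdeg w) = c * coord F (j, m).
Hypothesis cst_mon : forall c p x, cst c *: mon p x = mon p (c * x).

Definition top_vec : vec := [ffun u => (a u)%:Z - 1].

Lemma top_vecE u : top_vec u = (a u)%:Z - 1.
Proof. by rewrite ffunE. Qed.

Variable proj_top : {linear M -> M}.
Hypothesis coord_proj_top : forall F j m,
  coord (proj_top F) (j, m) = if j == top_vec then coord F (j, m) else 0.

Let free_gen : M := mon (top_vec, 0) 1.

Lemma coord0 p : coord 0 p = 0.
Proof. by rewrite -[0](scale0r 0) -(rmorph0 cst) coordZ mul0r. Qed.

Lemma coord_sum (I : Type) (s : seq I) (P : pred I) (F : I -> M) p :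
  coord (\sum_(i <- s | P i) F i) p = \sum_(i <- s | P i) coord (F i) p.
Proof. by apply: (big_morph (coord^~ p)) => [x y|]; [exact: coordD|exact: coord0]. Qed.

Lemma top_vec_valid m : pair_valid (top_vec, m) = inbox m.
Proof.
by apply/pair_validP/inboxP => V u; have := V u; rewrite top_vecE; lia.
Qed.

Lemma nonneg_top_sub m : inbox m -> nonneg (top_vec - m).
Proof. by move=> /inboxP V u; have := V u; rewrite vecD vecN top_vecE; lia. Qed.

Lemma inbox_top_sub m : inbox m -> inbox (top_vec - m).
Proof.
move=> /inboxP V; apply/inboxP => u; have := V u; rewrite vecD vecN top_vecE.
lia.
Qed.

Lemma inbox0 : inbox 0.
Proof. by apply/inboxP => u; rewrite vec0; have := a_gt0 u; lia. Qed.

Lemma inbox_top : inbox top_vec.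
Proof. by apply/inboxP => u; rewrite top_vecE; have := a_gt0 u; lia. Qed.

Lemma mono_top_gen m x : nonneg m -> exists y : L, y *: free_gen = mon (top_vec, m) x.
Proof.
move=> m0; have [c c0 wE] := word_mon (std_word m) (@nonneg0 n).
exists (cst (x / c) * word (std_word m)).
by rewrite -scalerA /free_gen wE cst_mon add0r wdeg_std // mulr1 divfK.
Qed.

(** The standard words map [free_gen] to multiples of distinct monomials. *)
Lemma free_gen_inj y : y *: free_gen = 0 -> y = 0.
Proof.
move=> y0; have [c E] := word_expand y; rewrite E big_seq big1 // => m; rewrite mem_box => mb.
suff -> : c m = 0 by rewrite rmorph0 mul0r.
have := congr1 (coord^~ (top_vec, m)) y0; rewrite coord0 E scaler_suml coord_sum.
have m0 := box_nonneg mb.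
have [d d0 wE] := word_mon (std_word m) (@nonneg0 n).
rewrite (bigD1_seq m) ?mem_box ?box_uniq //= -scalerA wE cst_mon coord_mon.
rewrite wdeg_std // add0r eqxx top_vec_valid mb mulr1.
rewrite big_seq_cond big1 ?addr0 => [/eqP|m' /andP[]].
  by rewrite mulf_eq0 (negPf d0) orbF => /eqP.
rewrite mem_box => m'b nm; have m'0 := box_nonneg m'b.
have [d' _ wE'] := word_mon (std_word m') (@nonneg0 n).
rewrite -scalerA wE' cst_mon coord_mon wdeg_std // add0r xpair_eqE eqxx /=.
by rewrite eq_sym (negPf nm).
Qed.

Lemma proj_top_gen F : exists y : L, y *: free_gen = proj_top F.
Proof.
have -> : proj_top F = \sum_(m <- box) mon (top_vec, m) (coord F (top_vec, m)).
  apply: coordP => -[j m]; rewrite coord_proj_top coord_sum.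
  have [V|nV] := boolP (pair_valid (j, m)); last first.
    rewrite coord_out // if_same big1 // => m' _; rewrite coord_mon.
    by case: eqP => //= <-; rewrite (negPf nV).
  have [jt|nj] := eqVneq j top_vec; last first.
    by rewrite big1 // => m' _; rewrite coord_mon xpair_eqE (negPf nj).
  have mb : inbox m by rewrite -top_vec_valid -jt.
  rewrite (bigD1_seq m) ?mem_box ?box_uniq //= coord_mon jt eqxx top_vec_valid mb.
  rewrite big1 ?addr0 // => m' nm.
  by rewrite coord_mon xpair_eqE [m == _]eq_sym (negPf nm) andbF.
rewrite big_seq; elim/big_ind: _ => [|F1 F2 [y1 <-] [y2 <-]|m].
- by exists 0; rewrite scale0r.
- by exists (y1 + y2); rewrite scalerDl.
by rewrite mem_box => /box_nonneg; apply: mono_top_gen.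
Qed.

Lemma proj_top_id : proj_top free_gen = free_gen.
Proof.
apply: coordP => -[j m]; rewrite coord_proj_top coord_mon xpair_eqE.
by case: eqP.
Qed.

Lemma module_retract : exists (s : {linear L^o -> M}) (r : {linear M -> L^o}),
  [/\ forall y, s y = (y : L) *: free_gen, cancel s r &
      forall F, proj_top F = (r F : L) *: free_gen].
Proof.
have /choice[r rE] := proj_top_gen.
have inj y z : y *: free_gen = z *: free_gen -> y = z.
  move=> E; apply/eqP; rewrite -subr_eq0; apply/eqP/free_gen_inj.
  by rewrite scalerBl E subrr.
have rlin : linear (r : M -> L^o).
  move=> c F G; apply: inj; rewrite rE linearP -!rE.
  by rewrite [RHS]scalerDl scalerA.
exists (mklin (scale_linear free_gen)), (mklin rlin); split=> // y.
by rewrite mklinE; apply: inj; rewrite rE linearZ_LR proj_top_id.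
Qed.

(** Words of positive length map [free_gen] to monomials other than 1. *)
Lemma aug_free_gen y : coord (y *: free_gen) (top_vec, 0) = aug y.
Proof.
move: y; apply: gen_ind => [|y z Ey Ez|c w].
- by rewrite scale0r coord0 rmorph0.
- by rewrite scalerDl coordD Ey Ez rmorphD.
rewrite -/(word w) -scalerA coordZ rmorphM aug_cst; congr (_ * _).
case: w => [|u w].
  by rewrite word_nil scale1r rmorph1 coord_mon eqxx top_vec_valid inbox0.
have [d _ ->] := word_mon (u :: w) (@nonneg0 n).
rewrite word_cons rmorphM aug_gen mul0r coord_mon add0r xpair_eqE eqxx /=.
case: eqP => // /ffunP/(_ u); rewrite vec0 wdeg_count /= eqxx.
by move=> /esym/eqP; rewrite eqz_nat.
Qed.

(** The coefficient of the top monomial is a Frobenius form: pairing a monomial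
    with its complement is nonzero, so that a linear form on E is the top
    coefficient of a unique map from E to the free module, which is linear by
    uniqueness. *)
Lemma frobenius (E : lmodType L) (f : E -> k) :
    (forall x y, f (x + y) = f x + f y) -> (forall c x, f (cst c *: x) = c * f x) ->
  exists2 h : {linear E -> M}, (forall x, proj_top (h x) = h x) &
    forall x y, coord (y *: h x) (top_vec, top_vec) = f (y *: x).
Proof.
move=> fD fZ.
have f0 : f 0 = 0 by rewrite -[0](scale0r 0) -(rmorph0 cst) fZ mul0r.
have top_word m : inbox m -> exists2 c, c != 0 &
    forall F,
      coord (word (std_word m) *: F) (top_vec, top_vec) = c * coord F (top_vec, top_vec - m).
  move=> mb; have m0 := box_nonneg mb.
  have := @coord_word (std_word m) top_vec (top_vec - m) (nonneg_top_sub mb).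
  by rewrite wdeg_std // subrK top_vec_valid => /(_ inbox_top).
have /choice[c cP] (m : vec) : exists c, inbox m -> c != 0 /\
    forall F,
      coord (word (std_word m) *: F) (top_vec, top_vec) = c * coord F (top_vec, top_vec - m).
  have [mb|] := boolP (inbox m); last by exists 0.
  by have [c c0 cE] := top_word m mb; exists c.
pose h x : M := \sum_(m <- box) mon (top_vec, top_vec - m) (f (word (std_word m) *: x) / c m).
have at_h x m : inbox m -> coord (h x) (top_vec, top_vec - m) = f (word (std_word m) *: x) / c m.
  move=> mb; rewrite coord_sum (bigD1_seq m) ?mem_box ?box_uniq //= coord_mon eqxx top_vec_valid.
  rewrite inbox_top_sub //= big1 ?addr0 // => m' nm; rewrite coord_mon xpair_eqE eqxx /=.
  by rewrite (inj_eq (addrI _)) eqr_opp eq_sym (negPf nm).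
have proj_h x : proj_top (h x) = h x.
  apply: coordP => -[j m]; rewrite coord_proj_top; case: eqP => // /eqP nj.
  by rewrite coord_sum big1 // => m' _; rewrite coord_mon xpair_eqE (negPf nj).
have h_form x y : coord (y *: h x) (top_vec, top_vec) = f (y *: x).
  have [d ->] := word_expand y; rewrite !scaler_suml coord_sum (big_morph f fD f0).
  rewrite big_seq [RHS]big_seq; apply: eq_bigr => m; rewrite mem_box => mb.
  rewrite -!scalerA coordZ fZ; congr (_ * _); have [c0 ->] := cP m mb.
  by rewrite at_h // mulrC divfK.
have form_inj F : proj_top F = F -> (forall y, coord (y *: F) (top_vec, top_vec) = 0) -> F = 0.
  move=> pF F0; apply: coordP => -[j m]; rewrite coord0.
  have [V|] := boolP (pair_valid (j, m)); last exact: coord_out.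
  rewrite -pF coord_proj_top; case: eqP => // jt; rewrite jt top_vec_valid in V *.
  have [c0 cE] := cP _ (inbox_top_sub V).
  have /eqP := F0 (word (std_word (top_vec - m))).
  by rewrite cE mulf_eq0 (negPf c0) /= opprB addrC subrK => /eqP.
have hlin : linear h.
  move=> z x y; apply/eqP; rewrite -subr_eq0; apply/eqP/form_inj.
    by rewrite linearB linearD linearZ_LR !proj_h.
  have fB u v : f (u - v) = f u - f v.
    by apply: (addIr (f v)); rewrite subrK -fD subrK.
  move=> y'; rewrite scalerBr scalerDr scalerA.
  have atB F G p : coord (F - G) p = coord F p - coord G p.
    by apply: (addIr (coord G p)); rewrite subrK -coordD subrK.
  by rewrite atB coordD !h_form scalerDr scalerA fD subrr.
by exists (mklin hlin).
Qed.

(** Take a nonzero multiple of a nonzero element by a word of maximal length. *)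
Lemma socle_exists (E : lmodType L) : ~ zero_module E ->
  exists2 s : E, s <> 0 & forall u, gen u *: s = 0.
Proof.
move=> nzE; have [x x0] : exists x : E, x <> 0.
  by apply: contrapT => nx; apply: nzE => x; apply: contrapT => x0; apply: nx; exists x.
pose P d := `[< exists w, size w = d /\ word w *: x <> 0 >].
have exP : exists d, P d by exists 0%N; apply/asboolP; exists [::]; rewrite word_nil scale1r.
have ubP d : P d -> (d <= \sum_u a u)%N.
  move=> /asboolP[w [<- wx]]; rewrite leqNgt; apply/negP => wa; apply: wx.
  rewrite (@deep_vanish (size w) (word w)) ?scale0r // -[word w]mul1r -(rmorph1 cst).
  exact: DeepW.
have [d /asboolP[w [wd wx]] maxd] := ex_maxnP exP ubP.
exists (word w *: x) => // u; rewrite scalerA -word_cons; apply: contrapT => ux.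
have := maxd (size (u :: w)); rewrite /= wd ltnn; move=> /(_ _)/negP; apply=> //.
by apply/asboolP; exists (u :: w); rewrite /= wd.
Qed.

(** The products of the standard words and of generators over L span E. *)
Lemma fin_gen_cst (E : lmodType L) : fin_gen E -> fin_gen (res cst E).
Proof.
case=> s gen_s.
apply: (@spanned_fin_gen _ (res cst E) [seq word (std_word m) *: e | m <- box, e <- s]) => x.
have [c ->] := gen_s x.
apply: (big_ind (spanned _)) => [|y z|i _]; [exact: Spanned0|exact: SpannedD|].
have [d ->] := word_expand (c i); rewrite scaler_suml big_seq.
apply: (big_ind (spanned _)) => [|y z|m mb]; [exact: Spanned0|exact: SpannedD|].
rewrite -scalerA; apply: (@SpannedZ _ (res cst E)).
by apply: allpairs_f => //; apply: mem_nth.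
Qed.

(** A nonzero injective module contains the trivial module, hence, by extension along
    the socle of the algebra, a copy of the algebra, which the Frobenius form
    splits off. *)
Lemma injective_retract (E : lmodType L) : fin_gen E -> ~ zero_module E -> injective_module E ->
  exists (s : {linear L^o -> E}) (h : {linear E -> L^o}), cancel s h.
Proof.
move=> fgE nzE injE; have [s s0 gs] := socle_exists nzE.
pose t : L := word (std_word top_vec).
have tn : nonneg top_vec := box_nonneg inbox_top.
have [kt kt0 tE] := word_mon (std_word top_vec) (@nonneg0 n).
have t0 : t <> 0.
  move=> t0; have := congr1 (coord^~ (top_vec, top_vec)) (tE top_vec 1).
  rewrite -/t t0 scale0r coord0 add0r wdeg_std // coord_mon eqxx top_vec_valid inbox_top.
  by rewrite mulr1 => /esym/eqP; rewrite (negPf kt0).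
have gt u : gen u *: (t : L^o) = 0.
  rewrite -[LHS]/(gen u * t) -word_cons; apply: (@word_vanish u).
  have cu : (a u)%:Z - 1 = (count_mem u (std_word top_vec))%:Z :> int.
    by rewrite -wdeg_count wdeg_std // top_vecE.
  have {cu} au : (a u <= (count_mem u (std_word top_vec)).+1)%N by lia.
  by rewrite /= eqxx add1n.
have triv_lin (E' : lmodType L) (x : E') (gx : forall u, gen u *: x = 0) :
    linear (fun c : K => cst (c : k) *: x).
  move=> y c d; rewrite -[cst (_ + _)]/(cst (aug y * (c : k) + (d : k))) rmorphD rmorphM.
  by rewrite scalerDl -cst_comm -scalerA -(socle_act gx) // !scalerA cst_comm.
have inj_t : injective (mklin (triv_lin L^o t gt)).
  apply: linear_inj0 => c; rewrite mklinE => ct; apply: contrapT => /eqP c0.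
  apply: t0; rewrite -[t]mul1r -(rmorph1 cst) -(mulVf c0) rmorphM -mulrA.
  by rewrite -[cst c * t]/(cst c *: (t : L^o)) ct mulr0.
have [h hE] := injE _ _ _ (mklin (triv_lin E s gs)) inj_t.
have hts : h t = s.
  by have := hE 1; rewrite !mklinE rmorph1 !scale1r.
pose e := h 1; have te : t *: e = s.
  by rewrite -linearZ_LR -[t *: _]/(t * 1) mulr1.
have idk (c : k) : (idfun : {rmorphism k -> k}) c <> 0 -> exists z, z * c = 1.
  by move=> /eqP c0; exists c^-1; rewrite mulVf.
have [r [p [gen_p coord_p]]] := local_coordinates idk (fin_gen_cst fgE).
have [f [fD fZ fs]] : exists f : E -> k, [/\ forall x y, f (x + y) = f x + f y,
    forall c x, f (cst c *: x) = c * f x & f s <> 0].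
  have [c sE] := gen_p s.
  have [i ci] : exists i, c i <> 0.
    apply: contrapT => nex; apply: s0; rewrite sE big1 // => i _.
    suff -> : c i = 0 by rewrite scale0r.
    by apply: contrapT => ci; apply: nex; exists i.
  have [f fE] := coord_p i; exists f; split.
  - by move=> x y; rewrite -[RHS]linearD.
  - by move=> d x; rewrite -[RHS]/(d *: f x) -linearZ_LR.
  - by rewrite sE fE.
have [hM projM formM] := frobenius fD fZ.
have [sM [rM [sME rK projE]]] := module_retract.
pose v : L := rM (hM e).
have vE : hM e = v *: free_gen by rewrite -projE projM.
have [z [_ vz]] : exists z, z * v = 1 /\ v * z = 1.
  apply: aug_unit; rewrite -aug_free_gen -vE => v0.
  apply: fs; rewrite -te -formM.
  have Vt : pair_valid (top_vec, 0 + wdeg (std_word top_vec)).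
    by rewrite add0r wdeg_std // top_vec_valid inbox_top.
  have [c _ cE] := coord_word (@nonneg0 n) Vt.
  by have := cE (hM e); rewrite add0r wdeg_std // v0 mulr0.
have rlin : linear (fun x : E => (rM (hM x) : L) * z : L^o).
  move=> y x x'.
  have -> : (rM (hM (y *: x + x')) : L) = y * (rM (hM x) : L) + (rM (hM x') : L).
    by rewrite !linearP.
  by rewrite mulrDl -mulrA.
exists (mklin (scale_linear e)), (mklin rlin) => y; rewrite !mklinE.
have -> : (rM (hM ((y : L) *: e)) : L) = (y : L) * v by rewrite !linearZ_LR.
by rewrite -mulrA vz mulr1.
Qed.

Lemma module_gen_cogen : gen_cogen M.
Proof.
move=> N fgN indN pi; have [nzN _] := indN.
have [s [h hK]] : exists (s : {linear L^o -> N}) (h : {linear N -> L^o}), cancel s h.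
  by case: pi => [pN|iN]; [exact: projective_retract|exact: injective_retract].
have [s' [r' [_ rK _]]] := module_retract.
exact: summand_transfer hK zero_free indN rK.
Qed.

End Cogenerator.

End Words.

(** * The representation dimension *)

Section Conclusion.
Variables (k : fieldType) (n : nat) (a : 'I_n -> nat) (q : 'I_n -> 'I_n -> k).
Hypothesis a_gt0 : forall u, (0 < a u)%N.
Local Notation L := (qci a q).

Lemma cst_zmod : zmod_morphism (qci_cst a q).
Proof. exact: qci_cstB. Qed.

Lemma cst_monoid : monoid_morphism (qci_cst a q).
Proof. by split=> [|c d]; [exact: qci_cst1|exact: qci_cstM]. Qed.

Definition qci_cst_morphism : {rmorphism k -> L} := HB.pack (qci_cst a q)
  (GRing.isZmodMorphism.Build _ _ _ cst_zmod)
  (GRing.isMonoidMorphism.Build _ _ _ cst_monoid).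

Let X0 (u : 'I_n) : {linear k^o -> k^o} := (\0 : {linear k^o -> k^o}).

Lemma X0_pow u v : iter (a u) (X0 u) v = 0.
Proof. by case: (a u) (a_gt0 u). Qed.

Lemma X0_comm (i j : 'I_n) v : (i < j)%N -> X0 i (X0 j v) = q i j *: X0 j (X0 i v).
Proof. by move=> _; rewrite /X0 /= scaler0. Qed.

(** The residue field; its action defines the augmentation. *)
Definition trivial_module : lmodType L := qrep X0_pow X0_comm.

Definition augmentation (y : L) : k := y *: (1 : trivial_module).

Lemma augmentation_act y (x : k) : y *: (x : trivial_module) = augmentation y * x.
Proof.
have xE : (x : trivial_module) = qci_cst a q x *: (1 : trivial_module)
  by rewrite qci_cst_act /= [RHS]mulr1.
rewrite {1}xE scalerA -qci_cst_comm -scalerA qci_cst_act; exact: mulrC.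
Qed.

Lemma augmentation_zmod : zmod_morphism augmentation.
Proof. by move=> y z; rewrite /augmentation scalerBl. Qed.

Lemma augmentation_monoid : monoid_morphism augmentation.
Proof.
split=> [|y z]; first by rewrite /augmentation scale1r.
by rewrite {1}/augmentation -scalerA augmentation_act.
Qed.

Definition aug_morphism : {rmorphism L -> k} := HB.pack augmentation
  (GRing.isZmodMorphism.Build _ _ _ augmentation_zmod)
  (GRing.isMonoidMorphism.Build _ _ _ augmentation_monoid).

Lemma aug_morphism_cst c : aug_morphism (qci_cst_morphism c) = c.
Proof. by rewrite -[LHS]/(qci_cst a q c *: (1 : trivial_module)) qci_cst_act; exact: mulr1. Qed.

Lemma aug_morphism_gen u : aug_morphism (qci_gen a q u) = 0.
Proof. by rewrite -[LHS]/(qci_gen a q u *: (1 : trivial_module)) qci_gen_act. Qed.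

Hypothesis q_neq0 : forall i j : 'I_n, (i < j)%N -> q i j != 0.
Local Notation M := (mon_module a q_neq0).

Lemma mcoef_word w (j m : vec n) : nonneg m -> pair_valid a (j, m + wdeg w) ->
  exists2 c, c != 0 & forall F : M,
    mcoef ((\prod_(u <- w) qci_gen a q u) *: F : M) (j, m + wdeg w) = c * mcoef F (j, m).
Proof.
move=> m0; elim: w => [|u w IH] V.
  by exists 1; rewrite ?oner_neq0 // => F; rewrite /wdeg !big_nil scale1r addr0 mul1r.
have wE : m + wdeg (u :: w) = m + wdeg w + unit_vec u.
  by rewrite /wdeg big_cons [unit_vec u + _]addrC addrA.
have mw0 : nonneg (m + wdeg w) := nonnegD m0 (@wdeg_nonneg n w).
rewrite wE in V *; have [c c0 E] := IH (pair_valid_sub mw0 (@nonneg_unit n u) V).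
exists (chi q (unit_vec u) (m + wdeg w) * c); first by rewrite mulf_neq0 // chi_neq0.
by move=> F; rewrite big_cons -scalerA qci_gen_mulX mcoef_mulX // E mulrA.
Qed.

Local Notation top_vec := (top_vec a).

Definition top_projection : {linear M -> M} := arrow a q_neq0 (top_vec, 0, top_vec) 1.

Lemma mcoef_proj_top (F : M) j m :
  mcoef (top_projection F) (j, m) = if j == top_vec then mcoef F (j, m) else 0.
Proof.
move: F; apply: mono_ind => [|F G IF IG|i r x V].
- by rewrite linear0 !mcoef0 if_same.
- by rewrite linearD !mcoefD IF IG; case: ifP; rewrite ?addr0.
rewrite /top_projection arrow_mono; last exact: pair_valid_nonneg V.
rewrite valid_id inbox_top // andTb.
rewrite (chi0r (chiDr q_neq0) (chi_neq0 q_neq0)) addr0 !mul1r.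
have [it|nit] := eqVneq i top_vec.
  by rewrite it mcoef_mono xpair_eqE; case: eqP.
rewrite mcoef0 mcoef_mono xpair_eqE; case: (j =P top_vec) => // ->.
by rewrite eq_sym (negPf nit).
Qed.

Lemma mon_module_gen_cogen : gen_cogen M.
Proof.
apply: (@module_gen_cogen k n a q q_neq0 L (qci_gen a q) qci_cst_morphism _ _ _ _
  aug_morphism _ _ a_gt0
  M (@mono k n a) (@mcoef k n a) _ _ _ _ _ _ _ _ top_projection).
- exact: qci_cst_comm.
- exact: qci_gen_pow.
- exact: qci_gen_comm.
- exact: qci_ind.
- exact: aug_morphism_cst.
- exact: aug_morphism_gen.
- exact: mcoefP.
- exact: mcoefD.
- by move=> c F p; rewrite -[qci_cst_morphism c]/(qci_cst a q c) qci_cst_act; exact: mcoefZ.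
- exact: mcoef_out.
- exact: mcoef_mono.
- exact: word_mono.
- exact: mcoef_word.
- exact: qci_cst_mono.
- exact: mcoef_proj_top.
Qed.

Lemma mon_module_fin_gen : fin_gen M.
Proof.
apply: (@spanned_fin_gen _ _ [seq (mono a (j, 0) 1 : M) | j <- box a]) => F.
move: F; apply: mono_ind => [|F G|j m x V]; [exact: Spanned0|exact: SpannedD|].
have [y <-] := mono_gen a q_neq0 j x (pair_valid_nonneg V).
apply: SpannedZ; apply: (map_f (fun j => mono a (j, 0) 1 : M)).
by rewrite mem_box; apply/inboxP => u; move/pair_validP/(_ u): V; lia.
Qed.

End Conclusion.

Lemma leqe_trans x y z : leqe x y -> leqe y z -> leqe x z.
Proof. by case: x y z => [x|] [y|] [z|] //=; apply: leq_trans. Qed.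

Theorem theorem3p2 (k : fieldType) (n : nat) (a : 'I_n -> nat)
    (q : 'I_n -> 'I_n -> k)
    (n_gt0 : (0 < n)%N)
    (a_ge2 : forall u : 'I_n, (2 <= a u)%N)
    (q_neq0 : forall i j : 'I_n, (i < j)%N -> q i j != 0) :
  leqe (repdim (qci a q)) (Some (2 * n)%N).
Proof.
have a_gt0 u : (0 < a u)%N := ltnW (a_ge2 u).
apply: leqe_trans (gldim_endo_mon_module a q_neq0).
have : leqe (repdim (qci a q)) (repdim (qci a q)) by case: (repdim _) => /=.
move=> /enat_inf_glb; apply; exists (mon_module a q_neq0); split=> //.
- exact: mon_module_fin_gen.
- exact: mon_module_gen_cogen.
Qed.
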